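(* Let $d\ge1$ be an integer, let $K, C, \delta > 0$, $0 < \underline{p} \leq \overline{p} < \infty$ with $\underline p\le 1\le\overline p$, and $\beta = \ell + \gamma$ with $\ell\ge 0$ an integer and $\gamma \in (0, 1]$. Then there exists a strictly positive constant $c = c(K, \beta, \underline{p}, \overline{p}, d, \delta, C)$ such that for every sample size $n\ge1$, $$\inf_{\widehat F} \ \sup_{(X, Y) \in \mathcal{P}(K, \beta, C, \delta, \underline{p}, \overline{p})} \mathbb{E}\bigg[\int_{\mathbb{R}} \big|F_{Y|X}(t|X) - \widehat F(t|X)\big|\, dt\bigg] \geq c\, n^{-\beta/(2\beta + d)},$$ where the infimum is taken over all estimators $\widehat F$ of $F_{Y|X}$ based on the sample $S_n$.
   Context: Setting. $(X,Y)$ is a pair of random variables with $X\sim \mathbb{P}_X$ supported on $[0,1]^d$ and $Y$ real-valued with atomless distribution. The conditional cdf is $F_{Y|X}(t|x) := \mathbb{P}\{Y\le t\mid X=x\}$. One observes an i.i.d. sample $S_n=\{(X_1,Y_1),\dots,(X_n,Y_n)\}$ with the same distribution as $(X,Y)$, and $X$ inside the risk is independent of $S_n$; the expectation is over both $S_n$ and $X$. An estimator $\widehat F(t|x)$ is a measurable function of $(t,x)$ and $S_n$. Notation. $\|x\|=\max_i|x_i|$ is the sup-norm on $\mathbb{R}^d$. For a multi-index $\alpha\in\{0,1,2,\dots\}^d$: $|\alpha|=\sum_i\alpha_i$, $\partial^\alpha=\prod_j\partial_j^{\alpha_j}$; derivatives $\partial^\alpha F(t|x)$ are taken with respect to $x$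 for fixed $t$. Smoothness class. For $\beta=\ell+\gamma$ with $\ell\ge0$ an integer and $\gamma\in(0,1]$, $\mathcal{D}(K,\beta)$ is the class of conditional cdfs $F_{Y|X}$ such that (i) for any $t$, the partial derivatives $\partial^\alpha F_{Y|X}(t|x)$ exist for all $|\alpha|\le\ell$; and (ii) for any $|\alpha|=\ell$ and any $x,y\in[0,1]^d$, $\int_{\mathbb{R}}|\partial^\alpha F_{Y|X}(t|x)-\partial^\alpha F_{Y|X}(t|y)|\,dt\le K\|x-y\|^\gamma$. Class of distributions. $\mathcal{P}(K,\beta,C,\delta,\underline p,\overline p)$ is the class of pairs $(X,Y)$ such that $F_{Y|X}\in\mathcal{D}(K,\beta)$, $\mathbb{E}[|Y|^{2+\delta}\mid X=x]\le C$ for all $x\in[0,1]^d$, and $\mathbb{P}_X$ has a density $p$ with $\underline p\le p(x)\le\overline p$ for all $x\in[0,1]^d$. *)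

(* Defs.v *)
From HB Require Import structures.
From mathcomp Require Import all_boot all_order all_algebra.
From mathcomp Require Import all_classical all_reals all_analysis.

Set Implicit Arguments.
Unset Strict Implicit.
Unset Printing Implicit Defensive.

Import Order.TTheory GRing.Theory Num.Theory.
Import numFieldNormedType.Exports.

Local Open Scope classical_set_scope.
Local Open Scope ring_scope.

(** ** Finite powers of a measure *)

Section cons_measure.
Local Open Scope ereal_scope.
Context (disp : measure_display) (T : measurableType disp) (R : realType).
Variables (n : nat) (mu : {sigma_finite_measure set T -> \bar R})
  (nu : {sigma_finite_measure set (n.-tuple T) -> \bar R}).

Definition tuple_cons (z : (T * n.-tuple T)%type) : n.+1.-tuple T :=
  [tuple of z.1 :: z.2].

Lemma measurable_tuple_cons : measurable_fun [set: (T * n.-tuple T)%type] tuple_cons.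
Proof.
exact: (@measurable_cons _ _ _ _ (@fst T (n.-tuple T)) n (@snd T (n.-tuple T))).
Qed.

Definition cons_measure : set (n.+1.-tuple T) -> \bar R :=
  pushforward (mu \x nu) tuple_cons.

Let cons_measure0 : cons_measure set0 = 0.
Proof. by rewrite /cons_measure /pushforward preimage_set0 measure0. Qed.

Let cons_measure_ge0 A : 0 <= cons_measure A.
Proof. by rewrite /cons_measure /pushforward measure_ge0. Qed.

Let cons_measure_sigma_additive : semi_sigma_additive cons_measure.
Proof.
move=> F mF tF mUF; rewrite /cons_measure /pushforward preimage_bigcup.
apply: measure_semi_sigma_additive.
- by move=> k; rewrite -[X in measurable X]setTI; exact: measurable_tuple_cons.
- apply/trivIsetP => i j _ _ ij; rewrite -preimage_setI.
  by move/trivIsetP : tF => /(_ i j Logic.I Logic.I ij) ->; rewrite preimage_set0.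
- rewrite -preimage_bigcup -[X in measurable X]setTI.
  exact: measurable_tuple_cons.
Qed.

HB.instance Definition _ := isMeasure.Build _ _ _ cons_measure
  cons_measure0 cons_measure_ge0 cons_measure_sigma_additive.

Let cons_measure_sigma_finite : sigma_finite setT cons_measure.
Proof.
have /sigma_finiteP[F [TF ndF Foo]] := sigma_finiteT mu.
have /sigma_finiteP[G [TG ndG Goo]] := sigma_finiteT nu.
pose uncons (u : n.+1.-tuple T) : (T * n.-tuple T)%type :=
  (thead u, [tuple of behead u]).
have munc : measurable_fun [set: n.+1.-tuple T] uncons.
  apply/measurable_fun_pairP; split.
    exact: measurable_tnth.
  exact: measurable_behead.
have unconsK z : uncons (tuple_cons z) = z.
  by case: z => x u; congr pair; apply: val_inj.
exists (fun k => uncons @^-1` (F k `*` G k)).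
  rewrite -preimage_bigcup (_ : \bigcup_k _ = setT) ?preimage_setT//.
  rewrite -setXTT TF TG predeqE => -[x y]; split.
    by move=> [k _ []/= ? ?]; split; exists k.
  move=> [/= [k _ Fkx] [l _ Gly]]; exists (maxn k l) => //; split.
  - by move: x Fkx; exact/subsetPset/ndF/leq_maxl.
  - by move: y Gly; exact/subsetPset/ndG/leq_maxr.
move=> k; have [mFk Fkoo] := Foo k; have [mGk Gkoo] := Goo k; split.
  by rewrite -[X in measurable X]setTI; apply: munc => //; exact: measurableX.
rewrite /cons_measure /pushforward.
rewrite (_ : tuple_cons @^-1` _ = F k `*` G k).
  by rewrite product_measure1E// lte_mul_pinfty// ge0_fin_numE.
by apply/funext => z; rewrite -[in RHS](unconsK z).
Qed.

HB.instance Definition _ := Measure_isSigmaFinite.Build _ _ _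
  cons_measure cons_measure_sigma_finite.

End cons_measure.

Section power_measure.
Local Open Scope ereal_scope.
Context (disp : measure_display) (T : measurableType disp) (R : realType).

Fixpoint power_measure (mu : {sigma_finite_measure set T -> \bar R}) (n : nat) :
    {sigma_finite_measure set (n.-tuple T) -> \bar R} :=
  match n return {sigma_finite_measure set (n.-tuple T) -> \bar R} with
  | 0 => \d_[tuple]
  | n'.+1 => cons_measure mu (power_measure mu n')
  end.

Lemma power_measure_box (mu : {sigma_finite_measure set T -> \bar R}) (n : nat)
    (A : 'I_n -> set T) : (forall i, measurable (A i)) ->
  power_measure mu n [set u | forall i, A i (tnth u i)] = \prod_(i < n) mu (A i).
Proof.
elim: n A => [|n IHn] A mA.
  rewrite big_ord0 /= diracE (_ : (_ \in _) = true)//.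
  by apply/mem_set; case.
rewrite big_ord_recl -IHn //= /cons_measure /pushforward.
rewrite -product_measure1E//; last first.
  rewrite (_ : [set _ | _] =
      \bigcap_i ((fun u : n.-tuple T => tnth u i) @^-1` A (lift ord0 i))).
    apply: fin_bigcap_measurable; first exact: finite_finset.
    by move=> i _; rewrite -[X in measurable X]setTI; exact: measurable_tnth.
  by apply/seteqP; split => u /= Au i => [_|]; apply: Au.
congr (_ _); apply/seteqP; split => [[x u]/= Au|[x u]/= [Ax Au] i].
  split => [|i]; first by have := Au ord0.
  by have := Au (lift ord0 i); rewrite /tuple_cons tnthS.
by case: (unliftP ord0 i) => [j|] ->; rewrite /tuple_cons ?tnthS.
Qed.

End power_measure.

(* [lebesgue_measure] is a measure on [measurableTypeR R], which has the same
   measurable sets as [R] but is a distinct structure (the displays differ);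
   here it is restated on [R] so that its powers live on [n.-tuple R]. *)
Section lebesgue_tuple.
Local Open Scope ereal_scope.
Context (R : realType).

Definition lebesgueR : set R -> \bar R := lebesgue_measure.

Let lebesgueR0 : lebesgueR set0 = 0.
Proof. exact: (measure0 (@lebesgue_measure R)). Qed.

Let lebesgueR_ge0 A : 0 <= lebesgueR A.
Proof. exact: (measure_ge0 (@lebesgue_measure R)). Qed.

Let lebesgueR_sigma_additive : semi_sigma_additive lebesgueR.
Proof.
exact: (@measure_semi_sigma_additive _ (measurableTypeR R) R lebesgue_measure).
Qed.

HB.instance Definition _ := isMeasure.Build _ R R lebesgueR
  lebesgueR0 lebesgueR_ge0 lebesgueR_sigma_additive.

Let lebesgueR_sigma_finite : sigma_finite [set: R] lebesgueR.
Proof. exact: (sigma_finiteT (@lebesgue_measure R)). Qed.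

HB.instance Definition _ := Measure_isSigmaFinite.Build _ R R lebesgueR
  lebesgueR_sigma_finite.

Definition lebesgue_tuple (d : nat) :
    {sigma_finite_measure set (d.-tuple R) -> \bar R} :=
  power_measure lebesgueR d.

End lebesgue_tuple.

(** ** Random pairs and conditional distributions *)

Section random_pair.
Context (d0 d1 d2 : measure_display) (T : measurableType d0)
  (T1 : measurableType d1) (T2 : measurableType d2) (R : realType).

Definition pair_fun (X : {mfun T >-> T1}) (Y : {mfun T >-> T2}) :
  T -> (T1 * T2)%type := fun w => (X w, Y w).

Lemma measurable_pair_fun (X : {mfun T >-> T1}) (Y : {mfun T >-> T2}) :
  measurable_fun [set: T] (pair_fun X Y).
Proof. by apply/measurable_fun_pairP; split; exact: measurable_funPT. Qed.

HB.instance Definition _ (X : {mfun T >-> T1}) (Y : {mfun T >-> T2}) :=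
  isMeasurableFun.Build _ _ _ _ (pair_fun X Y) (measurable_pair_fun X Y).

Definition joint_law (P : probability T R) (X : {RV P >-> T1}) (Y : {RV P >-> T2}) :
    probability (T1 * T2)%type R :=
  distribution P (pair_fun X Y).

(* [kappa] is a regular version of the conditional distribution of [Y] given
   [X]: [kappa x B] is P(Y \in B | X = x). *)
Definition is_conditional_law (P : probability T R) (X : {RV P >-> T1})
    (Y : {RV P >-> T2}) (kappa : R.-pker T1 ~> T2) : Prop :=
  forall A B, measurable A -> measurable B ->
    (joint_law X Y (A `*` B) = \int[distribution P X]_(x in A) kappa x B)%E.

End random_pair.

(** ** Functions on the unit cube *)

Section cube.
Context (R : realType) (d : nat).
Implicit Types (x y : d.-tuple R) (f : d.-tuple R -> R) (i : 'I_d).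

Definition cube : set (d.-tuple R) := [set x | forall i, 0 <= tnth x i <= 1].

Definition sup_dist x y : R := \big[Num.max/0]_(i < d) `|tnth x i - tnth y i|.

Definition shift_coord i x (h : R) : d.-tuple R :=
  [tuple tnth x j + (if j == i then h else 0) | j < d].

(* Increments are restricted to those that stay in the cube, so that the
   derivative is one-sided on the corresponding faces: [f] only matters on
   the cube. *)
Definition cube_increments i x : set_system R :=
  within [set h | cube (shift_coord i x h)] 0^'.

Definition pderivable i f x : Prop :=
  cvg (h^-1 * (f (shift_coord i x h) - f x) @[h --> cube_increments i x]).

Definition pderiv i f x : R :=
  lim (h^-1 * (f (shift_coord i x h) - f x) @[h --> cube_increments i x]).

Definition multi_index := 'I_d -> nat.

Definition mi_size (alpha : multi_index) : nat := (\sum_(i < d) alpha i)%N.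

(* The coordinates to differentiate along, as a list whose head is the
   outermost derivative, so that the list of [alpha] stands for the composite
   of the [alpha j]-fold derivatives along [j], in increasing order of [j]. *)
Definition mi_word (alpha : multi_index) : seq 'I_d :=
  flatten [seq nseq (alpha i) i | i <- enum 'I_d].

Definition pderivs (w : seq 'I_d) f : d.-tuple R -> R := foldr pderiv f w.

Fixpoint pderivs_exist (w : seq 'I_d) f : Prop :=
  if w is i :: w' then
    pderivs_exist w' f /\ (forall x, cube x -> pderivable i (pderivs w' f) x)
  else True.

Definition mi_deriv (alpha : multi_index) f : d.-tuple R -> R :=
  pderivs (mi_word alpha) f.

Definition mi_deriv_exists (alpha : multi_index) f : Prop :=
  pderivs_exist (mi_word alpha) f.

(* [F t x] stands for F(t|x); the smoothness exponent is ell + gamma. *)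
Definition smooth_cdf (K : R) (ell : nat) (gamma : R)
    (F : R -> d.-tuple R -> R) : Prop :=
  (forall t alpha, (mi_size alpha <= ell)%N -> mi_deriv_exists alpha (F t)) /\
  (forall alpha, mi_size alpha = ell -> forall x y, cube x -> cube y ->
    \int[lebesgue_measure]_t
        `|mi_deriv alpha (F t) x - mi_deriv alpha (F t) y|%:E
      <= (K * sup_dist x y `^ gamma)%:E)%E.

End cube.

(** ** The model and the minimax risk *)

Section model.
Context (R : realType) (d : nat).

Definition cond_cdf (kappa : R.-pker (d.-tuple R) ~> R) (t : R)
    (x : d.-tuple R) : R :=
  fine (kappa x `]-oo, t]%classic).

(* Since [F_{Y|X}] is evaluated at every point of the cube, a version [kappa] of
   the conditional distribution comes with the pair. *)
Record in_class (K : R) (ell : nat) (gamma C delta plow pupp : R)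
    (d0 : measure_display) (Omega : measurableType d0) (P : probability Omega R)
    (X : {RV P >-> d.-tuple R}) (Y : {RV P >-> R})
    (kappa : R.-pker (d.-tuple R) ~> R) : Prop := InClass {
  class_cond_law : is_conditional_law X Y kappa ;
  class_support : distribution P X (@cube R d) = 1%E ;
  class_atomless : forall y : R, distribution P Y [set y] = 0%E ;
  class_smooth : smooth_cdf K ell gamma (cond_cdf kappa) ;
  class_moment : forall x, cube x ->
    (\int[kappa x]_y (`|y| `^ (2 + delta))%:E <= C%:E)%E ;
  class_density : exists p : d.-tuple R -> R,
    [/\ measurable_fun [set: d.-tuple R] p,
        forall x, 0 <= p x,
        forall A, measurable A ->
          distribution P X A = (\int[lebesgue_tuple R d]_(x in A) (p x)%:E)%E &
        forall x, cube x -> plow <= p x <= pupp] }.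

(* An estimator takes (t, x) and the sample. *)
Definition estimator (n : nat) : Type :=
  {mfun (R * d.-tuple R * n.-tuple (d.-tuple R * R))%type >-> R}.

(* The sample has law [joint_law X Y] to the power n, and the point at which the
   estimator is evaluated is an independent copy of [X]. *)
Definition risk (d0 : measure_display) (Omega : measurableType d0)
    (P : probability Omega R) (X : {RV P >-> d.-tuple R}) (Y : {RV P >-> R})
    (kappa : R.-pker (d.-tuple R) ~> R) (n : nat) (Fhat : estimator n) : \bar R :=
  (\int[power_measure (joint_law X Y) n \x distribution P X]_z
     \int[lebesgue_measure]_t
       `|cond_cdf kappa t z.2 - Fhat (t, z.2, z.1)|%:E)%E.

Definition minimax_risk (K : R) (ell : nat) (gamma C delta plow pupp : R)
    (n : nat) : \bar R :=
  ereal_inf [set ereal_sup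
    [set r | exists (d0 : measure_display) (Omega : measurableType d0)
       (P : probability Omega R) (X : {RV P >-> d.-tuple R}) (Y : {RV P >-> R})
       (kappa : R.-pker (d.-tuple R) ~> R),
       in_class K ell gamma C delta plow pupp X Y kappa /\
       r = risk X Y kappa Fhat]
    | Fhat in [set: estimator n]].

End model.

(* Main.v *)
Require Import Defs.
From HB Require Import structures.
From mathcomp Require Import all_boot all_order all_algebra.
From mathcomp Require Import all_classical all_reals all_analysis.
From mathcomp Require Import measurable_realfun ring lra.

Set Implicit Arguments.
Unset Strict Implicit.
Unset Printing Implicit Defensive.

Import Order.TTheory GRing.Theory Num.Theory.
Import numFieldNormedType.Exports.

Local Open Scope classical_set_scope.
Local Open Scope ring_scope.

(** The lower bound is an Assouad argument over the hypercube of subsets of the cells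
    of a grid of size [m ^ d]. [X] is uniform on the cube and, given [X = x],
    [Y] is positive with probability [(1 + g x) / 2] and negative otherwise, its
    absolute value being uniform on [[a, 2 a]] and independent of its sign.
    The conditional cdf is then [G t + g x * S t] with [S] bounded, supported in
    [[-2 a, 2 a]] and equal to [- 1 / 2] on [[-a, a[], so that the smoothness of
    the cdf is that of [g], and the L1 distance between two such cdfs at [x] is
    at least [a * |g x - g' x|]. For [g] one takes the sums, over the cells in a
    given set, of bumps of width [1 / m] and height of order [m ^ - beta].
    Adding one bump [h] to [g] multiplies the law of [(X, Y)] by
    [1 + h x * sign y], whose second moment is [1 + E [h ^ 2]], at most
    [1 + O (m ^ - (2 beta + d))]. Hence for [m] of order
    [n ^ (1 / (2 beta + d))] the two n-sample laws share a fixed proportion of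
    their mass, and averaging the risk over all sets of cells bounds it below
    by a multiple of the integral of the sum of all bumps, that is of
    [m ^ - beta]. *)

(** * The bump profile and its derivatives *)

Section profile.
Context (R : realType).
Implicit Types (p q : {poly R}) (u v : R).

Definition clip v : R := Num.max 0 (Num.min v 1).

Lemma clip01 v : 0 <= clip v <= 1.
Proof.
by rewrite /clip le_max lexx ge_max ler01 ge_min lexx orbT.
Qed.

Lemma clip_id v : 0 <= v <= 1 -> clip v = v.
Proof. by move=> /andP[v0 v1]; rewrite /clip (min_idPl v1) (max_idPr v0). Qed.

Lemma clip_le0 v : v <= 0 -> clip v = 0.
Proof.
by move=> v0; rewrite /clip (min_idPl (le_trans v0 ler01)) (max_idPl v0).
Qed.

Lemma clip_ge1 v : 1 <= v -> clip v = 1.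
Proof. by move=> v1; rewrite /clip (min_idPr v1) (max_idPr ler01). Qed.

Lemma clip_lip u v : `|clip u - clip v| <= `|u - v|.
Proof.
wlog uv : u v / u <= v.
  by move=> H; case: (leP u v) => [/H//|/ltW/H]; rewrite distrC (distrC v u).
rewrite (ler0_norm (_ : u - v <= 0)) ?subr_le0//.
case: (leP v 0) => v0.
  by rewrite !clip_le0// ?(le_trans uv)// subrr normr0 oppr_ge0 subr_le0.
case: (leP 1 u) => u1.
  by rewrite !clip_ge1// ?(le_trans u1)// subrr normr0 oppr_ge0 subr_le0.
have [u0|u0] := leP u 0; have [v1|v1] := leP v 1.
- by rewrite (clip_le0 u0) (@clip_id v) ?(ltW v0)// sub0r normrN gtr0_norm//; lra.
- by rewrite (clip_le0 u0) (clip_ge1 (ltW v1)) sub0r normrN normr1; lra.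
- rewrite (@clip_id u) ?(ltW u0) ?(ltW u1)// (@clip_id v) ?(ltW v0)//.
  by rewrite ler0_norm// subr_le0.
- rewrite (@clip_id u) ?(ltW u0) ?(ltW u1)// (clip_ge1 (ltW v1)).
  by rewrite ler0_norm; lra.
Qed.

Lemma measurable_clip : measurable_fun setT clip.
Proof. by apply: measurable_maxr => //; exact: measurable_minr. Qed.

(** Induction along Horner's scheme. The constants carry absolute values because the induction
    hypothesis does not make [L] nonnegative. *)
Lemma poly_lipschitz01 p : exists L : R, forall u v,
  0 <= u <= 1 -> 0 <= v <= 1 -> `|p.[u] - p.[v]| <= L * `|u - v|.
Proof.
elim/poly_ind: p => [|p c [L HL]].
  by exists 0 => u v _ _; rewrite !horner0 subrr normr0 mul0r.
exists (`|L| + (`|p.[0]| + `|L|)) => u v u01 v01.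
have -> : (p * 'X + c%:P).[u] - (p * 'X + c%:P).[v] =
  (p.[u] - p.[v]) * u + p.[v] * (u - v).
  by rewrite !hornerE; ring.
have pv : `|p.[v]| <= `|p.[0]| + `|L|.
  have := HL v 0 v01; rewrite lexx ler01 => /(_ isT) H.
  rewrite -[p.[v]](subrK p.[0]) addrC (le_trans (ler_normD _ _))// lerD2l.
  rewrite (le_trans H)// subr0 (le_trans (ler_wpM2r _ (ler_norm _)))//.
  rewrite ler_piMr// ger0_norm; last by case/andP: v01.
  by case/andP: v01.
rewrite (le_trans (ler_normD _ _))// [leRHS]mulrDl lerD//.
- rewrite normrM (le_trans (ler_piMr _ _))//.
    by rewrite ger0_norm; case/andP: u01.
  by rewrite (le_trans (HL _ _ u01 v01))// ler_wpM2r// ler_norm.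
- by rewrite normrM ler_wpM2r.
Qed.

(** Each differentiation removes at most one factor [q]. With [q = X (1 - X)] and [N = ell + 1], the
    derivatives of order at most [ell] therefore vanish at 0 and 1. *)
Lemma derivn_exp_factor q N e : (e <= N)%N ->
  exists r : {poly R}, (q ^+ N)^`(e) = q ^+ (N - e) * r.
Proof.
elim: e => [|e IH] eN; first by exists 1; rewrite derivn0 subn0 mulr1.
have [r Hr] := IH (ltnW eN).
rewrite derivnS Hr -(subnSK eN) exprS.
exists (q^`() * r *+ (N - e.+1).+1 + q * r^`()).
rewrite -exprS derivM deriv_exp /= -mulrnAl exprS mulrDr.
by rewrite -!mulrA -!(mulrCA (q ^+ _)) mulrnAl.
Qed.

(* The [e]-th derivative of [(v (1 - v)) ^ (ell + 1)] on [[0, 1]], extended by 0: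
   for [e <= ell] it vanishes at 0 and 1, so clipping the argument extends it. *)
Definition profile (ell e : nat) v : R :=
  ((('X * (1 - 'X)) ^+ ell.+1)^`(e)).[clip v].

Lemma profile_eq0 ell e v : (e <= ell)%N -> (v <= 0) || (1 <= v) ->
  profile ell e v = 0.
Proof.
move=> el v01; rewrite /profile.
have [r ->] := @derivn_exp_factor ('X * (1 - 'X)) _ _ (leqW el).
rewrite subSn// exprS.
by case/orP: v01 => H; [rewrite clip_le0|rewrite clip_ge1]; rewrite // !hornerE/=;
  rewrite ?(subrr, mulr0, mul0r).
Qed.

Lemma profile_neq0 ell e v : (e <= ell)%N -> profile ell e v != 0 -> 0 < v < 1.
Proof.
move=> el; apply: contraNT; rewrite negb_and -!leNgt.
by move=> /(profile_eq0 el) ->.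
Qed.

Lemma profile0E ell v : profile ell 0 v = (clip v * (1 - clip v)) ^+ ell.+1.
Proof. by rewrite /profile derivn0 !hornerE. Qed.

Lemma profile0_ge0 ell v : 0 <= profile ell 0 v.
Proof.
rewrite profile0E exprn_ge0// mulr_ge0//; have /andP[? ?] := clip01 v => //.
by rewrite subr_ge0.
Qed.

Lemma profile0_le1 ell v : profile ell 0 v <= 1.
Proof.
have /andP[? ?] := clip01 v.
rewrite profile0E exprn_ile1//; first by rewrite mulr_ge0// subr_ge0.
by rewrite mulr_ile1// ?subr_ge0// gerBl.
Qed.

Lemma profile_lipschitz ell : exists2 L : R, 0 < L &
  forall e u v, (e <= ell)%N -> `|profile ell e u - profile ell e v| <= L * `|u - v|.
Proof.
pose P e := (('X * (1 - 'X)) ^+ ell.+1)^`(e) : {poly R}.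
have [L HL] := choice (fun e => poly_lipschitz01 (P e)).
(* The sum dominates the constants of all orders up to [ell] at once, and the 1 makes it
   positive. *)
exists (1 + \sum_(e < ell.+1) `|L e|); first by rewrite ltr_pwDl// sumr_ge0.
move=> e u v el; rewrite (le_trans (HL e _ _ (clip01 _) (clip01 _)))//.
rewrite (le_trans (ler_wpM2r _ (ler_norm _)))//.
rewrite (le_trans (ler_wpM2l _ (clip_lip _ _)))// ler_wpM2r//.
rewrite (bigD1 (Ordinal (_ : e < ell.+1)%N))//= addrCA lerDl.
by rewrite addr_ge0// sumr_ge0.
Qed.

(** The quotient has the form used in [pderiv], so that partial derivatives of bumps reduce to it by
    an affine change of variable. *)
Definition has_diffq (f : R -> R) v (l : R) : Prop :=
  h^-1 * (f (v + h) - f v) @[h --> 0^'] --> l.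

Lemma has_diffq_horner p v : has_diffq (horner p) v p^`().[v].
Proof.
have [] := is_derive_poly p v.
move=> /[swap] <- => H; rewrite /has_diffq.
have -> : (fun h => h^-1 * (p.[v + h] - p.[v])) =
  (fun h : R => h^-1 *: (((horner p) \o shift v) (h *: (1:R)) - p.[v])).
  by apply/funext => h /=; rewrite /GRing.scale/= mulr1 [h + v]addrC.
exact: H.
Qed.

Lemma has_diffq_cst c v : has_diffq (cst c) v 0.
Proof.
rewrite /has_diffq /cst/= (_ : (fun _ => _) = cst 0); first exact: cvg_cst.
by apply/funext => h; rewrite subrr mulr0.
Qed.

(** Which of [f1] and [f2] agrees with [f] may vary with [h]; this covers a change of branch at
    [v]. *)
Lemma has_diffq_paste f f1 f2 v l :
  has_diffq f1 v l -> has_diffq f2 v l -> f1 v = f v -> f2 v = f v ->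
  (\forall h \near 0^', f (v + h) = f1 (v + h) \/ f (v + h) = f2 (v + h)) ->
  has_diffq f v l.
Proof.
move=> /cvgrPdist_lt f1l /cvgrPdist_lt f2l fv1 fv2 near12.
apply/cvgrPdist_lt => e e0; near=> h.
have : f (v + h) = f1 (v + h) \/ f (v + h) = f2 (v + h) by near: h.
case=> ->.
- by rewrite -fv1; near: h; exact: f1l.
- by rewrite -fv2; near: h; exact: f2l.
Unshelve. all: by end_near.
Qed.

(** The clipped function is [p] on [[0, 1]] and 0 outside. At both ends the two branches have value
    and derivative 0, so they can be pasted. *)
Lemma has_diffq_clip p v : p.[0] = 0 -> p.[1] = 0 ->
  p^`().[0] = 0 -> p^`().[1] = 0 ->
  has_diffq (fun u => p.[clip u]) v p^`().[clip v].
Proof.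
move=> p0 p1 dp0 dp1.
have out u : (u <= 0) || (1 <= u) -> p.[clip u] = 0.
  by case/orP => H; [rewrite clip_le0|rewrite clip_ge1].
have pcase u : p.[clip u] = p.[u] \/ p.[clip u] = 0.
  have [u0|u0] := leP u 0; first by right; rewrite out ?u0.
  have [u1|u1] := leP 1 u; first by right; rewrite out ?u1 ?orbT.
  by left; rewrite clip_id// !ltW.
have near_in (a b : R) : a < v < b -> \forall h \near 0^', a < v + h < b.
  move=> /andP[av vb]; have e0 : 0 < Num.min (v - a) (b - v).
    by rewrite lt_min !subr_gt0 av.
  apply: filterS (dnbhs0_lt e0) => h; rewrite lt_min ltr_norml ltr_norml.
  by move=> /andP[/andP[? ?] /andP[? ?]]; apply/andP; split; lra.
have diff0 : p^`().[clip v] = 0 -> has_diffq (cst 0) v p^`().[clip v].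
  by move=> ->; exact: has_diffq_cst.
have [v0|v0|v0] := ltgtP v 0.
- have d0 : has_diffq (cst 0) v p^`().[clip v].
    by apply: diff0; rewrite clip_le0 ?ltW.
  apply: (has_diffq_paste d0 d0) => //; rewrite ?out ?(ltW v0)//.
  apply: filterS (near_in (v - 1) 0 _); last by apply/andP; split; lra.
  by move=> h /andP[_ /ltW vh]; left; rewrite out ?vh.
- have [v1|v1|v1] := ltgtP v 1.
  + have d1 : has_diffq (horner p) v p^`().[clip v].
      by rewrite clip_id ?(ltW v0) ?(ltW v1)//; exact: has_diffq_horner.
    apply: (has_diffq_paste d1 d1) => //; rewrite ?clip_id ?(ltW v0) ?(ltW v1)//.
    apply: filterS (near_in 0 1 _); last by rewrite v0.
    by move=> h /andP[h0 h1]; left; rewrite clip_id// !ltW.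
  + have d0 : has_diffq (cst 0) v p^`().[clip v].
      by apply: diff0; rewrite clip_ge1 ?ltW.
    apply: (has_diffq_paste d0 d0) => //; rewrite ?out ?(ltW v1) ?orbT//.
    apply: filterS (near_in 1 (v + 1) _); last by apply/andP; split; lra.
    by move=> h /andP[/ltW vh _]; left; rewrite out ?vh ?orbT.
  + rewrite v1 (clip_ge1 (lexx _)).
    apply: (@has_diffq_paste _ (horner p) (cst 0)).
    * exact: has_diffq_horner.
    * by rewrite dp1; exact: has_diffq_cst.
    * by rewrite clip_ge1.
    * by rewrite clip_ge1.
    * exact: nearW.
- rewrite v0 (clip_le0 (lexx _)).
  apply: (@has_diffq_paste _ (horner p) (cst 0)).
  * exact: has_diffq_horner.
  * by rewrite dp0; exact: has_diffq_cst.
  * by rewrite clip_le0.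
  * by rewrite clip_le0.
  * exact: nearW.
Qed.

(** The inequality is strict because the derivative of order [e + 1] must still vanish at 0 and
    1. *)
Lemma has_diffq_profile ell e v : (e < ell)%N ->
  has_diffq (profile ell e) v (profile ell e.+1 v).
Proof.
move=> el.
have root j (x : R) : (j <= ell)%N -> x * (1 - x) = 0 ->
    (('X * (1 - 'X)) ^+ ell.+1 : {poly R})^`(j).[x] = 0.
  move=> jl x0; have [r ->] := @derivn_exp_factor ('X * (1 - 'X)) _ _ (leqW jl).
  by rewrite subSn// exprS !hornerE x0 !mul0r.
rewrite /profile [(_)^`(e.+1)]derivnS; apply: has_diffq_clip; rewrite -?derivnS root//.
- exact: ltnW.
- by rewrite mul0r.
- exact: ltnW.
- by rewrite subrr mulr0.
- by rewrite mul0r.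
- by rewrite subrr mulr0.
Qed.

Lemma measurable_profile0 ell : measurable_fun setT (profile ell 0).
Proof.
rewrite (_ : profile ell 0 = fun v => (clip v * (1 - clip v)) ^+ ell.+1).
  apply: measurable_funX; apply: measurable_funM; last apply: measurable_funB => //.
  - exact: measurable_clip.
  - exact: measurable_clip.
by apply/funext => v; rewrite profile0E.
Qed.

End profile.

(** * Sums of bumps on the cube *)

Section cube_increments.
Context (R : realType) (d : nat).
Implicit Types (x y : d.-tuple R) (i j : 'I_d).

Lemma tnth_shift_coord i x h j :
  tnth (shift_coord i x h) j = tnth x j + (if j == i then h else 0).
Proof. by rewrite tnth_mktuple. Qed.

Lemma cube_shift_coord i x h : cube x -> 0 <= tnth x i + h <= 1 ->
  cube (shift_coord i x h).
Proof.
move=> cx xh j; rewrite tnth_shift_coord; case: eqP => [->//|_].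
by rewrite addr0; exact: cx.
Qed.

(** Properness makes the limit in [pderiv] unique. It holds on the faces too: a coordinate at most
    [1 / 2] can be increased inside the cube, any other can be decreased. *)
Lemma cube_increments_proper i x : cube x -> ProperFilter (cube_increments i x).
Proof.
move=> cx; apply: Build_ProperFilter_ex => A.
rewrite /cube_increments /within/= => /nbhs_ballP[e /= e0 He].
have /andP[x0 x1] := cx i.
pose r := Num.min (e / 2) (1 / 2).
have r0 : 0 < r by rewrite lt_min !divr_gt0.
have re : r < e.
  by rewrite (@le_lt_trans _ _ (e / 2))// ?ge_min ?lexx//; lra.
have r2 : r <= 1 / 2 by rewrite ge_min lexx orbT.
have [xh|xh] := leP (tnth x i) (1 / 2).
- exists r; apply: He.
  + by rewrite /ball/= sub0r normrN gtr0_norm.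
  + by rewrite gt_eqF.
  + by apply: cube_shift_coord => //; apply/andP; split; lra.
- exists (- r); apply: He.
  + by rewrite /ball/= sub0r normrN normrN gtr0_norm.
  + by rewrite oppr_eq0 gt_eqF.
  + by apply: cube_shift_coord => //; apply/andP; split; lra.
Qed.

Lemma pderiv_within i (f g : d.-tuple R -> R) x l : cube x ->
  (forall y, cube y -> f y = g y) ->
  h^-1 * (g (shift_coord i x h) - g x) @[h --> 0^'] --> (l : R) ->
  pderivable i f x /\ pderiv i f x = l.
Proof.
move=> cx fg gl.
have H : h^-1 * (f (shift_coord i x h) - f x) @[h --> cube_increments i x] --> l.
  apply: (cvg_trans _ (cvg_within_filter [set h | cube (shift_coord i x h)] gl)).
  apply: near_eq_cvg; rewrite /cube_increments near_withinE.
  by apply: nearW => h hx; rewrite !fg.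
have P := cube_increments_proper i cx.
split; first by apply/cvg_ex; exists l.
exact/cvg_lim.
Qed.

End cube_increments.

Section bump_sum.
Context (R : realType) (d ell m : nat).
Implicit Types (x y : d.-tuple R) (i j : 'I_d) (e : 'I_d -> nat).

Definition cell := {ffun 'I_d -> 'I_m}.

Implicit Types (k : cell) (w : cell -> R).

(** The family [e] gives the order of differentiation in each coordinate. The chain rule factors [m]
    are not included; they go into the weights of [bump_sum]. *)
Definition cell_bump e k x : R :=
  \prod_(i < d) profile ell (e i) (m%:R * tnth x i - (k i)%:R).

(** A shape stable under differentiation. For fixed [t] the conditional cdf has it, with [c] and [w]
    depending on [t]. *)
Definition bump_sum (c : R) w e x : R := c + \sum_k w k * cell_bump e k x.

Lemma bump_neq0 e k x : (forall i, (e i <= ell)%N) -> cell_bump e k x != 0 ->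
  forall i, (k i)%:R < m%:R * tnth x i < (k i)%:R + 1.
Proof.
move=> el /prodf_neq0 nz i.
by have /(profile_neq0 (el i)) := nz i isT; rewrite subr_gt0 ltrBlDl.
Qed.

(** The open cells are disjoint, so at most one bump is nonzero at [x], whatever the orders [e]. *)
Lemma exists_cell x : (0 < m)%N -> exists k0, forall k e,
  (forall i, (e i <= ell)%N) -> k != k0 -> cell_bump e k x = 0.
Proof.
move=> m0.
have [[k0 Hk0]|nk] := pselect (exists k0 : cell,
    forall i, (k0 i)%:R < m%:R * tnth x i < (k0 i)%:R + 1); last first.
  (* If [x] lies in no open cell then all bumps vanish there, and any index will do. *)
  exists [ffun => Ordinal m0] => k e el _; apply/eqP/negP => /negP H.
  by apply: nk; exists k; exact: bump_neq0 H.
exists k0 => k e el; apply: contraNeq => /(bump_neq0 el) Hk.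
apply/eqP/ffunP => i; apply/val_inj/eqP => /=.
have /andP[k1 k2] := Hk i; have /andP[k3 k4] := Hk0 i.
rewrite eqn_leq; apply/andP; split; rewrite -ltnS -(ltr_nat R) -natr1.
- exact: lt_trans k1 k4.
- exact: lt_trans k3 k2.
Qed.

Lemma diffq_bump e k x i : (0 < m)%N -> (e i < ell)%N ->
  h^-1 * (cell_bump e k (shift_coord i x h) - cell_bump e k x) @[h --> 0^'] -->
  m%:R * cell_bump (fun j => (e j + (j == i))%N) k x.
Proof.
move=> m0 el.
have mR : m%:R != 0 :> R by rewrite pnatr_eq0 -lt0n.
pose C := \prod_(j < d | j != i) profile ell (e j) (m%:R * tnth x j - (k j)%:R).
pose v := m%:R * tnth x i - (k i)%:R.
have bE h : cell_bump e k (shift_coord i x h) = profile ell (e i) (v + m%:R * h) * C.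
  rewrite /cell_bump (bigD1 i)//= tnth_shift_coord eqxx; congr (_ * _).
    by congr profile; rewrite /v; ring.
  by apply: eq_bigr => j /negPf ji; rewrite tnth_shift_coord ji addr0.
have -> : cell_bump (fun j => (e j + (j == i))%N) k x = profile ell (e i).+1 v * C.
  rewrite /cell_bump (bigD1 i)//= eqxx addn1; congr (_ * _).
  by apply: eq_bigr => j /negPf ji; rewrite ji addn0.
have -> : (fun h => h^-1 * (cell_bump e k (shift_coord i x h) - cell_bump e k x)) =
    (fun h => m%:R * ((m%:R * h)^-1 *
     (profile ell (e i) (v + m%:R * h) - profile ell (e i) v)) * C).
  apply/funext => h; rewrite bE.
  have -> : cell_bump e k x = profile ell (e i) v * C by rewrite /cell_bump (bigD1 i).
  by rewrite invfM mulrA mulrA mulfV// mul1r; ring.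
have /= := @has_diffq_profile R ell (e i) v el.
rewrite /has_diffq => H.
have : m%:R * h @[h --> (0:R)^'] --> (0:R)^'.
  move=> A; rewrite /nbhs/= /dnbhs/= /within/= => /nbhs_ballP[r /= r0 HA].
  apply/nbhs_ballP; exists (r / m%:R); first by rewrite /= divr_gt0// ltr0n.
  move=> h; rewrite /ball/= sub0r normrN ltr_pdivlMr ?ltr0n// => hr h0.
  apply: HA; last by rewrite mulf_neq0.
  by rewrite /ball/= sub0r normrN normrM ger0_norm// mulrC.
move=> /cvg_comp /(_ H) {}H; rewrite mulrA.
exact: (cvgMr_tmp (cvgMl_tmp (a := m%:R) H)).
Qed.

Lemma diffq_bump_sum c w e x i : (0 < m)%N -> (e i < ell)%N ->
  h^-1 * (bump_sum c w e (shift_coord i x h) - bump_sum c w e x) @[h --> 0^'] -->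
  bump_sum 0 (fun k => m%:R * w k) (fun j => (e j + (j == i))%N) x.
Proof.
move=> m0 el; rewrite /bump_sum add0r.
have -> : (fun h => h^-1 * (c + \sum_k w k * cell_bump e k (shift_coord i x h) -
                     (c + \sum_k w k * cell_bump e k x))) =
  (fun h => \sum_k w k * (h^-1 * (cell_bump e k (shift_coord i x h) - cell_bump e k x))).
  apply/funext => h; rewrite opprD addrACA subrr add0r -sumrB mulr_sumr.
  by apply: eq_bigr => k _; ring.
under eq_bigr do rewrite -mulrA mulrCA.
apply: cvg_big => [|k _]; first exact: add_continuous.
by apply: cvgMl_tmp; exact: diffq_bump.
Qed.

(** Each derivative multiplies the weights by [m] and raises one order by 1; the first one removes
    the constant. The length of [s] bounds every order reached, which keeps the profiles
    differentiable. *)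
Lemma pderivs_bump_sum c w (f : d.-tuple R -> R) (s : seq 'I_d) :
  (0 < m)%N -> (size s <= ell)%N ->
  (forall x, cube x -> f x = bump_sum c w (fun=> 0%N) x) ->
  pderivs_exist s f /\ forall x, cube x -> pderivs s f x =
    bump_sum (if s is [::] then c else 0) (fun k => m%:R ^+ size s * w k)
      (fun j => count_mem j s) x.
Proof.
move=> m0 + fE; elim: s => [|i s IH] /= sl.
  by split=> // x /fE ->; rewrite /bump_sum; under [in RHS]eq_bigr do rewrite mul1r.
have [ex E] := IH (ltnW sl).
have cl : (count_mem i s < ell)%N by rewrite (leq_ltn_trans (count_size _ _)).
have H x (cx : cube x) := pderiv_within (i := i) cx E
  (@diffq_bump_sum _ _ _ x _ m0 cl).
split; first by split=> // x /H[].
move=> x /H[_ ->]; rewrite /bump_sum; congr (_ + _); apply: eq_bigr => k _.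
by rewrite exprS mulrA; congr (_ * _); apply: eq_bigr => j _; rewrite addnC eq_sym.
Qed.

End bump_sum.

Section bump_sum_holder.
Context (R : realType) (d : nat).
Implicit Types (x y : d.-tuple R) (i : 'I_d).

(** Telescoping: one factor is exchanged at a time, the others being bounded by [L]. *)
Lemma dist_prod_le (I : Type) (s : seq I) (a b : I -> R) (L D : R) :
  1 <= L -> 0 <= D ->
  (forall j, `|a j| <= L) -> (forall j, `|b j| <= L) ->
  (forall j, `|a j - b j| <= D) ->
  `|\prod_(j <- s) a j - \prod_(j <- s) b j| <= (size s)%:R * L ^+ size s * D.
Proof.
move=> L1 D0 aL bL abD; have L0 := le_trans ler01 L1.
have prodL s' : `|\prod_(j <- s') b j| <= L ^+ size s'.
  elim: s' => [|j s' IH]; first by rewrite big_nil normr1.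
  by rewrite big_cons normrM /= exprS ler_pM.
elim: s => [|j s IH]; first by rewrite !big_nil subrr normr0 mul0r mul0r.
rewrite !big_cons.
have -> (p q : R) : a j * p - b j * q = a j * (p - q) + (a j - b j) * q by ring.
rewrite (le_trans (ler_normD _ _))// !normrM /= -natr1 mulrDl mul1r mulrDl lerD//.
  by rewrite exprS mulrCA -!mulrA ler_pM// mulrA.
rewrite mulrC ler_pM// (le_trans (prodL s))// exprS ler_peMl// exprn_ge0//.
Qed.

Lemma dist_le_sup_dist x y i : `|tnth x i - tnth y i| <= sup_dist x y.
Proof. exact: (le_bigmax _ (fun i => `|tnth x i - tnth y i|)). Qed.

Lemma sup_dist_ge0 x y : 0 <= sup_dist x y.
Proof. exact: bigmax_ge_id. Qed.

(** Turns a uniform bound together with a Lipschitz bound into a Hölder bound of exponent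
    [gamma]. *)
Lemma min1_le_powR (s gamma : R) : 0 <= s -> 0 < gamma -> gamma <= 1 ->
  Num.min 1 s <= s `^ gamma.
Proof.
move=> s0 g0 g1; have [s1|s1] := leP 1 s.
  by rewrite (le_trans _ (ler_powR s1 (ltW g0)))// powRr0.
have [->|sn0] := eqVneq s 0; first by rewrite powR0 ?gt_eqF.
by rewrite ger1_powR// (ltW s1) lt_neqAle eq_sym sn0 s0.
Qed.

(* For given [x] and [y] at most two of the bumps contribute, so the constant
   does not depend on the number [m] of cells per axis. *)
Lemma bump_sum_holder ell : exists2 M : R, 0 < M &
  forall m c (w : cell d m -> R) (W : R) (e : 'I_d -> nat) x y gamma,
  (0 < m)%N -> (forall i, (e i <= ell)%N) -> (forall k, `|w k| <= W) ->
  0 < gamma -> gamma <= 1 ->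
  `|bump_sum ell c w e x - bump_sum ell c w e y| <=
    W * M * (m%:R * sup_dist x y) `^ gamma.
Proof.
have [L L0 HL] := profile_lipschitz R ell.
pose L1 := 1 + L.
(* The first term serves for [s < 1], by the Lipschitz bound on a product of [d] profiles; the
   second for [1 <= s], where both values are at most [L1 ^+ d]. *)
pose B := d%:R * L1 ^+ d * L1 + 2 * L1 ^+ d.
have L11 : 1 <= L1 by rewrite lerDl ltW.
have L1d : 1 <= L1 ^+ d by rewrite exprn_ege1.
have B0 : 0 < B.
  rewrite ltr_wpDl//; last by rewrite mulr_gt0// (lt_le_trans ltr01).
  by rewrite !mulr_ge0// ?exprn_ge0// (le_trans ler01).
exists (2 * B); first by rewrite mulr_gt0.
move=> m c w W e x y gamma m0 el wW g0 g1.
set s := m%:R * sup_dist x y.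
have s0 : 0 <= s by rewrite mulr_ge0// sup_dist_ge0.
have W0 : 0 <= W.
  exact: le_trans (normr_ge0 _) (wW [ffun => Ordinal m0]).
have profL j v : (j <= ell)%N -> `|profile ell j v| <= L1.
  (* The profile sees only [clip v] and vanishes at 0, so its Lipschitz constant also bounds its
     values. *)
  move=> jl; have -> : profile ell j v = profile ell j (clip v) - profile ell j 0.
    rewrite (profile_eq0 (v := 0))// ?lexx// subr0.
    by rewrite /profile (clip_id (clip01 v)).
  have /andP[c0 c1] := clip01 v.
  rewrite (le_trans (HL _ _ _ jl))// subr0 ger0_norm//.
  by rewrite (le_trans (ler_piMr (ltW L0) c1))// lerDr.
have bumpL (k : cell d m) z : `|cell_bump ell e k z| <= L1 ^+ d.
  have -> : L1 ^+ d = \prod_(i < d) L1 by rewrite prodr_const card_ord.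
  by rewrite /cell_bump normr_prod; apply: ler_prod => i _; rewrite normr_ge0 profL.
have bump_diff (k : cell d m) : `|cell_bump ell e k x - cell_bump ell e k y| <= B * s `^ gamma.
  rewrite (le_trans _ (ler_wpM2l (ltW B0) (min1_le_powR s0 g0 g1)))//.
  have [s1|s1] := leP 1 s.
    rewrite mulr1 (le_trans (ler_normB _ _))// (le_trans (lerD (bumpL _ _) (bumpL _ _)))//.
    by rewrite /B [2 * _]mulr_natl mulr2n lerDr !mulr_ge0// ?exprn_ge0// (le_trans ler01).
  rewrite (le_trans (dist_prod_le (L := L1) (D := L1 * s) _ L11 _ _ _ _))//.
  - by rewrite mulr_ge0// (le_trans ler01).
  - by move=> i; exact: profL.
  - by move=> i; exact: profL.
  - move=> i; rewrite (le_trans (HL _ _ _ (el i)))//.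
    rewrite ler_pM// ?(ltW L0)// ?lerDr//.
    have -> : m%:R * tnth x i - (val (k i))%:R - (m%:R * tnth y i - (val (k i))%:R) =
      m%:R * (tnth x i - tnth y i) by ring.
    by rewrite normrM ger0_norm// ler_wpM2l// dist_le_sup_dist.
  - rewrite /index_enum -enumT size_enum_ord mulrA ler_wpM2r//.
    by rewrite lerDl mulr_ge0// (le_trans ler01).
have [kx Hx] := exists_cell ell x m0.
have [ky Hy] := exists_cell ell y m0.
rewrite /bump_sum opprD addrACA subrr add0r -sumrB.
have term (k : cell d m) : `|w k * cell_bump ell e k x - w k * cell_bump ell e k y| <=
    W * (B * s `^ gamma).
  by rewrite -mulrBr normrM ler_pM.
have T0 : 0 <= W * (B * s `^ gamma) by rewrite !mulr_ge0// ?(ltW B0)// powR_ge0.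
have -> : W * (2 * B) * s `^ gamma = W * (B * s `^ gamma) + W * (B * s `^ gamma).
  by ring.
rewrite (bigD1 kx)//= (le_trans (ler_normD _ _))// lerD//.
have [xy|xy] := eqVneq kx ky.
  rewrite big1 ?normr0// => k kkx; rewrite Hx// Hy//; last by rewrite -xy.
  by rewrite mulr0 subrr.
rewrite (bigD1 ky)/=; last by rewrite eq_sym.
rewrite big1 ?addr0// => k /andP[kkx kky].
by rewrite Hx// Hy// mulr0 subrr.
Qed.

End bump_sum_holder.

(** * Powers of measures and two-point testing *)

Section power_measure_integral.
Local Open Scope ereal_scope.
Context (disp : measure_display) (T : measurableType disp) (R : realType).
Implicit Types (mu nu : {sigma_finite_measure set T -> \bar R}).

Lemma ge0_integral_power_measureS mu n (f : n.+1.-tuple T -> \bar R) :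
  measurable_fun setT f -> (forall u, 0 <= f u) ->
  \int[power_measure mu n.+1]_u f u =
  \int[mu]_x \int[power_measure mu n]_u f (tuple_cons (x, u)).
Proof.
move=> mf f0; rewrite /= /cons_measure.
rewrite (ge0_integral_pushforward (@measurable_tuple_cons _ T n))//.
rewrite preimage_setT fubini_tonelli1//; last by move=> z; exact: f0.
exact: measurableT_comp mf (@measurable_tuple_cons _ T n).
Qed.

Lemma measurable_tnth_prod n (l : T -> R) : measurable_fun setT l ->
  measurable_fun setT (fun u : n.-tuple T => \prod_(i < n) l (tnth u i))%R.
Proof.
move=> ml.
elim: (index_enum _) => [|i s IH].
  by under eq_fun do rewrite big_nil; exact: measurable_cst.
under eq_fun do rewrite big_cons.
apply: measurable_funM => //.
exact: measurableT_comp ml (measurable_tnth i).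
Qed.

Lemma tuple_cons_prod n (l : T -> R) x (u : n.-tuple T) :
  (\prod_(i < n.+1) l (tnth (tuple_cons (x, u)) i) =
   l x * \prod_(i < n) l (tnth u i))%R.
Proof.
by rewrite big_ord_recl; congr (_ * _)%R; apply: eq_bigr => i _; rewrite tnthS.
Qed.

Lemma measurable_tuple_cons2 n x :
  measurable_fun setT (fun u : n.-tuple T => tuple_cons (x, u)).
Proof.
exact: measurableT_comp (@measurable_tuple_cons _ T n) (@pair1_measurable _ _ _ _ x).
Qed.

(** Densities multiply under products; the induction integrates out the first coordinate last. The
    density is expressed by integrals of nonnegative functions, the form in which the explicit joint
    laws are compared. *)
Lemma power_measure_density mu nu (l : T -> R) :
  measurable_fun setT l -> (forall x, 0 <= l x)%R ->
  (forall f : T -> \bar R, measurable_fun setT f -> (forall x, 0 <= f x) ->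
    \int[nu]_x f x = \int[mu]_x (f x * (l x)%:E)) ->
  forall n (f : n.-tuple T -> \bar R),
    measurable_fun setT f -> (forall u, 0 <= f u) ->
    \int[power_measure nu n]_u f u =
    \int[power_measure mu n]_u (f u * (\prod_(i < n) l (tnth u i))%:E).
Proof.
move=> ml l0 dens; elim=> [|n IH] f mf f0.
  by apply: eq_integral => u _; rewrite big_ord0 mule1.
have L0 k (u : k.-tuple T) : (0 <= \prod_(i < k) l (tnth u i))%R.
  exact: prodr_ge0.
rewrite ge0_integral_power_measureS// [RHS]ge0_integral_power_measureS//; last first.
- by move=> u; rewrite mule_ge0// lee_fin L0.
- apply: emeasurable_funM => //; apply/measurable_EFinP; exact: measurable_tnth_prod.
have mfc x : measurable_fun setT (fun u : n.-tuple T => f (tuple_cons (x, u))).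
  exact: measurableT_comp mf (measurable_tuple_cons2 _).
have mL : measurable_fun setT (fun u : n.-tuple T =>
    (\prod_(i < n) l (tnth u i))%:E).
  by apply/measurable_EFinP; exact: measurable_tnth_prod.
under eq_integral do rewrite IH//.
rewrite dens; last 2 first.
- apply: (measurable_fun_fubini_tonelli_F (m2 := power_measure mu n) (fun z =>
    f (tuple_cons z) * (\prod_(i < n) l (tnth z.2 i))%:E)).
    apply: emeasurable_funM; first exact: measurableT_comp mf (@measurable_tuple_cons _ T n).
    exact: measurableT_comp mL measurable_snd.
  by move=> z; rewrite mule_ge0// lee_fin.
- by move=> x; apply: integral_ge0 => u _; rewrite mule_ge0// lee_fin.
apply: eq_integral => x _.
rewrite -ge0_integralZr//; last 3 first.
- by apply: emeasurable_funM.
- by move=> u _; rewrite mule_ge0// lee_fin.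
- by rewrite lee_fin.
apply: eq_integral => u _.
by rewrite tuple_cons_prod EFinM -muleA; congr (_ * _); rewrite muleC.
Qed.

Lemma ge0_integral_power_measure_prod mu n (l : T -> R) :
  measurable_fun setT l -> (forall x, 0 <= l x)%R ->
  \int[power_measure mu n]_u (\prod_(i < n) l (tnth u i))%:E =
  (\int[mu]_x (l x)%:E) ^+ n.
Proof.
move=> ml l0.
have L0 k (u : k.-tuple T) : (0 <= \prod_(i < k) l (tnth u i))%R.
  exact: prodr_ge0.
have mL k : measurable_fun setT (fun u : k.-tuple T =>
    (\prod_(i < k) l (tnth u i))%:E).
  by apply/measurable_EFinP; exact: measurable_tnth_prod.
elim: n => [|n IH].
  under eq_integral do rewrite big_ord0.
  by rewrite integral_cst//= mul1e diracT.
rewrite ge0_integral_power_measureS//; last by move=> u; rewrite lee_fin.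
transitivity (\int[mu]_x ((l x)%:E * (\int[mu]_y (l y)%:E) ^+ n)).
  apply: eq_integral => x _; under eq_integral do rewrite tuple_cons_prod EFinM.
  rewrite ge0_integralZl// ?lee_fin ?IH//; first exact: mL.
  by move=> u _; rewrite lee_fin.
rewrite expeS ge0_integralZr//.
- by apply/measurable_EFinP.
- by move=> x _; rewrite lee_fin.
- by rewrite expe_ge0// integral_ge0// => x _; rewrite lee_fin.
Qed.

Lemma power_measure_setT (mu : probability T R) n :
  power_measure mu n setT = 1.
Proof.
have := @power_measure_box _ _ _ mu n (fun=> setT) (fun=> measurableT).
rewrite (_ : [set _ | _] = setT); last by apply/seteqP.
by move=> ->; rewrite big1// => i _; exact: probability_setT.
Qed.

End power_measure_integral.

Section two_points.
Local Open Scope ereal_scope.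
Context (disp : measure_display) (T : measurableType disp) (R : realType).

(* [min 1 L >= L - L ^ 2 / 4], so the mass shared by the two n-fold laws is
   controlled by the second moment of the likelihood ratio [L]. *)
Lemma two_point_lower_bound (mu nu : probability T R) (l : T -> R) (eps Delta : R) n
    (f0 f1 : n.-tuple T -> \bar R) :
  measurable_fun setT l -> (forall x, 0 <= l x)%R ->
  (forall f : T -> \bar R, measurable_fun setT f -> (forall x, 0 <= f x) ->
    \int[nu]_x f x = \int[mu]_x (f x * (l x)%:E)) ->
  \int[mu]_x (l x ^+ 2)%:E <= (1 + eps)%:E -> ((1 + eps) ^+ n <= 3)%R ->
  measurable_fun setT f0 -> (forall u, 0 <= f0 u) ->
  measurable_fun setT f1 -> (forall u, 0 <= f1 u) ->
  (0 <= Delta)%R -> (forall u, Delta%:E <= f0 u + f1 u) ->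
  (Delta / 4)%:E <=
    \int[power_measure mu n]_u f0 u + \int[power_measure nu n]_u f1 u.
Proof.
move=> ml l0 dens l2 eps3 mf0 f00 mf1 f10 D0 Df.
pose L (u : n.-tuple T) : R := (\prod_(i < n) l (tnth u i))%R.
have L0 u : (0 <= L u)%R by apply: prodr_ge0.
have mL : measurable_fun setT L by exact: measurable_tnth_prod.
have mLE : measurable_fun setT (fun u => (L u)%:E) by apply/measurable_EFinP.
pose M u := Num.min 1%R (L u).
have M0 u : (0 <= M u)%R by rewrite le_min ler01 L0.
have mM : measurable_fun setT (fun u => (M u)%:E).
  by apply/measurable_EFinP; exact: measurable_minr.
have mL2 : measurable_fun setT (fun u => (L u ^+ 2)%:E).
  by apply/measurable_EFinP; exact: measurable_funX.
have IL : \int[power_measure mu n]_u (L u)%:E = 1.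
  have <- : \int[power_measure nu n]_u (cst 1 u) = 1.
    by rewrite integral_cst// mul1e; exact: power_measure_setT.
  rewrite (power_measure_density ml l0 dens)//.
  by apply: eq_integral => u _; rewrite mul1e.
have IL2 : \int[power_measure mu n]_u (L u ^+ 2)%:E <= 3%:E.
  under eq_integral => u _ do rewrite /L -prodrXl.
  rewrite (ge0_integral_power_measure_prod _ _ (l := fun x => (l x ^+ 2)%R)) //.
  - have : 0 <= \int[mu]_x (l x ^+ 2)%:E.
      by apply: integral_ge0 => x _; rewrite lee_fin sqr_ge0.
    move: l2; case: (\int[mu]_x _) => // r; rewrite !lee_fin => r1 r0.
    by rewrite -EFin_expe lee_fin (le_trans _ eps3)// lerXn2r// nnegrE// (le_trans r0).
  - exact: measurable_funX.
  - by move=> x; rewrite sqr_ge0.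
have IM : (1 / 4)%:E <= \int[power_measure mu n]_u (M u)%:E.
  (* The inequality [min 1 L >= L - L ^ 2 / 4] is integrated in additive form, so that all
     integrands stay nonnegative. *)
  have : 1 <= \int[power_measure mu n]_u (M u)%:E + (3 / 4)%:E.
    rewrite -IL; apply: (@le_trans _ _ (\int[power_measure mu n]_u (M u)%:E +
        (1 / 4)%:E * \int[power_measure mu n]_u (L u ^+ 2)%:E)).
      rewrite -ge0_integralZl ?lee_fin//; last first.
        by move=> u _; rewrite lee_fin sqr_ge0.
      rewrite -ge0_integralD//; last 3 first.
      - by move=> u _; rewrite lee_fin.
      - by move=> u _; rewrite mule_ge0// lee_fin// sqr_ge0.
      - by apply: emeasurable_funM.
      apply: ge0_le_integral => //.
      - by move=> u _; rewrite lee_fin.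
      - by apply: emeasurable_funD => //; apply: emeasurable_funM.
      - move=> u _; rewrite -EFinM -EFinD lee_fin /M.
        case: (leP 1%R (L u)) => _; last by have := sqr_ge0 (L u); lra.
        by have := sqr_ge0 (L u - 2); rewrite sqrrB; lra.
    rewrite leeD2l// (_ : (3 / 4)%R = (1 / 4 * 3)%R); last by lra.
    by rewrite [leRHS]EFinM lee_wpmul2l// lee_fin.
  rewrite -leeBlDr//; apply: le_trans.
  by rewrite -EFinB lee_fin; lra.
rewrite [X in _ + X](power_measure_density ml l0 dens)//.
have fL0 u : 0 <= f1 u * (L u)%:E by rewrite mule_ge0// lee_fin.
have mfL : measurable_fun setT (fun u => f1 u * (L u)%:E).
  exact: emeasurable_funM.
rewrite -ge0_integralD//.
(* Pointwise, [f0 + f1 * L >= (f0 + f1) * min 1 L >= Delta * min 1 L]. *)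
apply: (@le_trans _ _ (\int[power_measure mu n]_u (Delta%:E * (M u)%:E))).
  rewrite ge0_integralZl//.
  - by rewrite [leLHS]EFinM lee_wpmul2l// (le_trans _ IM)// lee_fin; lra.
  - by move=> u _; rewrite lee_fin.
apply: ge0_le_integral => //.
- by move=> u _; rewrite mule_ge0// lee_fin.
- exact: emeasurable_funM.
- exact: emeasurable_funD.
move=> u _; apply: (@le_trans _ _ ((f0 u + f1 u) * (M u)%:E)).
  by rewrite lee_wpmul2r// lee_fin.
rewrite ge0_muleDl// leeD//.
  by rewrite -[leRHS]mule1 lee_wpmul2l// lee_fin ge_min lexx.
by rewrite lee_wpmul2l// lee_fin ge_min lexx orbT.
Qed.

End two_points.

(** * The response given the covariate *)

Section uniform_measures.
Local Open Scope ereal_scope.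
Context (R : realType).

Definition unif01 : set R -> \bar R :=
  mrestr (@lebesgueR R) (measurable_itv `[0%R, 1%R]).

HB.instance Definition _ := Measure.on unif01.

Let unif01_setT : unif01 setT = 1.
Proof.
rewrite /unif01 /mrestr setTI /lebesgueR lebesgue_measure_itv/= lte_fin ltr01.
by rewrite sube0.
Qed.

HB.instance Definition _ := Measure_isProbability.Build _ _ _ unif01 unif01_setT.

Lemma unif01_le (q : R) : (0 <= q <= 1)%R -> unif01 [set u | (u <= q)%R] = q%:E.
Proof.
move=> /andP[q0 q1]; rewrite /unif01 /mrestr.
have -> : [set u | (u <= q)%R] `&` `[0%R, 1%R] = `[0%R, q]%classic.
  apply/seteqP; split => u /=; rewrite !in_itv/=.
    by move=> [uq /andP[-> _]].
  by move=> /andP[-> uq]; split => //; rewrite (le_trans uq).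
rewrite /lebesgueR lebesgue_measure_itv/= lte_fin sube0.
by case: ltP => // q0'; congr EFin; apply/eqP; rewrite eq_le q0 q0'.
Qed.

Lemma unif01_full (A : set R) : measurable A -> (forall v, (0 <= v <= 1)%R -> A v) ->
  unif01 A = 1.
Proof.
move=> mA HA; rewrite -unif01_setT /unif01 /mrestr; congr (lebesgueR _).
apply/seteqP; split => v /= [Av]; rewrite in_itv/= => v01; split => //.
exact: HA.
Qed.

Lemma unif01_null (A : set R) : measurable A -> (forall v, (0 <= v <= 1)%R -> ~ A v) ->
  unif01 A = 0.
Proof.
move=> mA HA; rewrite /unif01 /mrestr (_ : _ `&` _ = set0).
  exact: (measure0 (@lebesgueR R)).
by apply/seteqP; split => v //= [Av]; rewrite in_itv/= => /HA.
Qed.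

Lemma le_unif01 (A B : set R) : measurable A -> measurable B ->
  (forall v, (0 <= v <= 1)%R -> A v -> B v) -> unif01 A <= unif01 B.
Proof.
move=> mA mB AB; rewrite /unif01 /mrestr.
apply: (le_measure (@lebesgueR R)); rewrite ?inE.
- by apply: measurableI => //; exact: measurable_itv.
- by apply: measurableI => //; exact: measurable_itv.
- by move=> v /= [Av]; rewrite in_itv/= => v01; split => //; exact: AB.
Qed.

Lemma unif01_set1 (v : R) : unif01 [set v] = 0.
Proof.
apply/eqP; rewrite eq_le measure_ge0 andbT.
rewrite -(lebesgue_measure_set1 v) /unif01 /mrestr.
apply: (le_measure (@lebesgueR R)); rewrite ?inE//.
by apply: measurableI => //; exact: measurable_itv.
Qed.

Lemma measurable_box d (l r : 'I_d -> R) :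
  measurable [set x : d.-tuple R | forall i, l i <= tnth x i <= r i]%R.
Proof.
rewrite [X in measurable X](_ : _ = \bigcap_(i in [set: 'I_d])
    ((fun x => tnth x i) @^-1` `[l i, r i]%classic)); last first.
  apply/seteqP; split=> x cx i; first by move=> _ /=; rewrite in_itv/=; exact: cx.
  by have := cx i Logic.I; rewrite /= in_itv.
apply: fin_bigcap_measurable; first exact: finite_finset.
move=> i _; rewrite -[X in measurable X]setTI.
by apply: measurable_tnth => //; exact: measurable_itv.
Qed.

Lemma measurable_cube d : measurable (@cube R d).
Proof. exact: (@measurable_box d (fun=> 0%R) (fun=> 1%R)). Qed.

Definition unif_cube d : set (d.-tuple R) -> \bar R :=
  mrestr (lebesgue_tuple R d) (@measurable_cube d).

Arguments unif_cube : clear implicits.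

HB.instance Definition _ d := Measure.on (unif_cube d).

Lemma lebesgue_tuple_box d (l r : 'I_d -> R) : (forall i, l i <= r i)%R ->
  lebesgue_tuple R d [set x | forall i, l i <= tnth x i <= r i]%R =
  (\prod_(i < d) (r i - l i))%:E.
Proof.
move=> lr; rewrite /lebesgue_tuple.
rewrite (@power_measure_box _ _ _ _ _ (fun i => `[l i, r i]%classic)); last first.
  by move=> i; exact: measurable_itv.
rewrite -prodEFin; apply: eq_bigr => i _; rewrite /= /lebesgueR.
rewrite lebesgue_measure_itv/= lte_fin; case: ltP => //.
by move=> rl; have -> : r i = l i; [apply/eqP; rewrite eq_le rl lr|rewrite subrr].
Qed.

Let unif_cube_setT d : unif_cube d setT = 1.
Proof.
rewrite /unif_cube /mrestr setTI (lebesgue_tuple_box (l := fun=> 0%R) (r := fun=> 1%R))//.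
by rewrite big1// => i _; rewrite subr0.
Qed.

HB.instance Definition _ d :=
  Measure_isProbability.Build _ _ _ (unif_cube d) (unif_cube_setT d).

Lemma unif_cube_box d (l r : 'I_d -> R) :
  (forall i, 0 <= l i)%R -> (forall i, l i <= r i)%R -> (forall i, r i <= 1)%R ->
  unif_cube d [set x | forall i, l i <= tnth x i <= r i]%R =
  (\prod_(i < d) (r i - l i))%:E.
Proof.
move=> l0 lr r1; rewrite -lebesgue_tuple_box// /unif_cube /mrestr.
congr (lebesgue_tuple R d _); apply/seteqP; split => x /= => [[]//|xlr].
split => // i; have /andP[lx xr] := xlr i.
by rewrite (le_trans (l0 i))// (le_trans xr).
Qed.

Lemma unif_cube_cube d : unif_cube d (@cube R d) = 1.
Proof. by rewrite -(unif_cube_setT d) /unif_cube /mrestr setTI setIid. Qed.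

End uniform_measures.

Arguments unif_cube : clear implicits.
Arguments unif01 : clear implicits.

Section response.
Local Open Scope ereal_scope.
Context (R : realType) (a : R).
Implicit Types (q t v : R) (w : R * R).

(** Clipping confines the value to [[a, 2 a]] for every real [v], also off the support of [unif01],
    so the bounds below hold everywhere. *)
Definition magnitude v : R := (a * (1 + clip v))%R.

(* [w] stands for a pair of independent uniform variables on [[0, 1]]. *)
Definition response q w : R :=
  if (w.1 <= q)%R then magnitude w.2 else (- magnitude w.2)%R.

Lemma measurable_magnitude : measurable_fun setT magnitude.
Proof.
apply: measurable_funM => //; apply: measurable_funD => //.
exact: measurable_clip.
Qed.

Lemma measurable_response_comp d (T : measurableType d) (q : T -> R) (w : T -> R * R) :
  measurable_fun setT q -> measurable_fun setT w ->
  measurable_fun setT (fun x => response (q x) (w x)).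
Proof.
move=> mq mw.
have mm : measurable_fun setT (fun x => magnitude (w x).2).
  apply: measurableT_comp measurable_magnitude _.
  exact: measurableT_comp measurable_snd mw.
apply: measurable_fun_ifT => //.
- apply: measurable_fun_ler => //; exact: measurableT_comp measurable_fst mw.
- exact: measurable_funN.
Qed.

Lemma measurable_response q : measurable_fun setT (response q).
Proof. by apply: measurable_response_comp => //; exact: measurable_cst. Qed.

HB.instance Definition _ q := isMeasurableFun.Build _ _ _ _ _ (measurable_response q).

Definition noise : probability (R * R)%type R := (unif01 R \x unif01 R).

(** By Tonelli the variable deciding the sign is integrated first; it is at most [q] with
    probability [q]. *)
Lemma ge0_integral_response q (f : R -> \bar R) : (0 <= q <= 1)%R ->
  measurable_fun setT f -> (forall y, 0 <= f y) ->
  \int[noise]_w f (response q w) =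
  \int[unif01 R]_v (q%:E * f (magnitude v) + (1 - q)%:E * f (- magnitude v)%R).
Proof.
move=> q01 mf f0.
rewrite (fubini_tonelli2 (fun w => f (response q w)))//; last first.
  exact: measurableT_comp mf (measurable_response q).
apply: eq_integral => v _; rewrite /fubini_G /response /=.
have mA : measurable [set u : R | (u <= q)%R].
  by rewrite -[X in measurable X]setTI; apply: measurable_fun_ler.
set A := [set u | _] in mA.
transitivity (\int[unif01 R]_u (f (magnitude v) * (\1_A u)%:E +
   f (- magnitude v)%R * (\1_(~` A) u)%:E)).
  apply: eq_integral => u _; rewrite !indicE in_setC.
  have -> : (u \in A) = (u <= q)%R by apply/idP/idP; rewrite inE.
  by case: ifP => _ /=; rewrite ?mule1 ?mule0 ?adde0 ?add0e.
have mC := measurableC mA.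
have mI (B : set R) : measurable B -> measurable_fun setT (fun u => (\1_B u)%:E : \bar R).
  by move=> mB; apply/measurable_EFinP; exact: measurable_indic.
rewrite ge0_integralD//; last 4 first.
- by move=> u _; rewrite mule_ge0// lee_fin.
- by apply: emeasurable_funM; [exact: measurable_cst|exact: mI].
- by move=> u _; rewrite mule_ge0// lee_fin.
- by apply: emeasurable_funM; [exact: measurable_cst|exact: mI].
rewrite !ge0_integralZl//; try exact: mI; try by move=> u _; rewrite lee_fin.
rewrite !integral_indic// !setIT muleC; congr (_ + _).
  by congr (_ * _); exact: unif01_le.
rewrite muleC; congr (_ * _).
transitivity (1 - unif01 R A); last by rewrite unif01_le// EFinB.
exact: (probability_setC (unif01 R)).
Qed.

(** For [s = 1] and [s = - 1], the cdf of the response given that it is positive, respectively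
    negative. *)
Definition half_cdf (s : R) t : R :=
  fine (unif01 R [set v | (s * magnitude v <= t)%R]).

(* With [q = (1 + g) / 2], the cdf of [response q] is [cdf_mean + g * cdf_tilt]. *)
Definition cdf_mean t : R := ((half_cdf 1%R t + half_cdf (- 1)%R t) / 2)%R.
Definition cdf_tilt t : R := ((half_cdf 1%R t - half_cdf (- 1)%R t) / 2)%R.

Lemma measurable_half_cdf_set s t : measurable [set v : R | (s * magnitude v <= t)%R].
Proof.
rewrite -[X in measurable X]setTI; apply: measurable_fun_ler => //.
by apply: measurable_funM => //; exact: measurable_magnitude.
Qed.

Lemma half_cdfK s t : (half_cdf s t)%:E = unif01 R [set v | (s * magnitude v <= t)%R].
Proof.
by rewrite fineK// fin_num_measure//; exact: measurable_half_cdf_set.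
Qed.

Lemma half_cdf01 s t : (0 <= half_cdf s t <= 1)%R.
Proof.
rewrite -!lee_fin half_cdfK measure_ge0 probability_le1//.
exact: measurable_half_cdf_set.
Qed.

(** The parameter [q] enters only as a mixture weight, so the cdf is affine in it; smoothness in [x]
    is thereby inherited from the tilt. *)
Lemma response_cdf q t : (0 <= q <= 1)%R ->
  fine (distribution noise (response q) `]-oo, t]%classic) =
  (cdf_mean t + (2 * q - 1) * cdf_tilt t)%R.
Proof.
move=> q01.
have mt : measurable (`]-oo, t]%classic : set R) by exact: measurable_itv.
have -> : distribution noise (response q) `]-oo, t]%classic =
    \int[noise]_w (\1_(`]-oo, t]%classic) (response q w))%:E.
  rewrite /distribution /pushforward -[X in noise X]setIT.
  rewrite -(integral_indic noise measurableT)//.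
  by rewrite -[X in measurable X]setTI; exact: measurable_response.
rewrite (ge0_integral_response (f := fun y => (\1_(`]-oo, t]%classic) y)%:E))//; last first.
  by apply/measurable_EFinP; exact: measurable_indic.
have /andP[q0 q1] := q01.
have halfE (s : R) : (fun v => (\1_(`]-oo, t]%classic) (s * magnitude v)%R)%:E) =
    (fun v => (\1_[set v | (s * magnitude v <= t)%R] v)%:E) :> (R -> \bar R).
  by apply/funext => v; rewrite !indicE; congr ((nat_of_bool _)%:R%:E).
have mh (s : R) : measurable_fun setT
    (fun v => (\1_(`]-oo, t]%classic) (s * magnitude v)%R)%:E : \bar R).
  rewrite halfE; apply/measurable_EFinP; apply: measurable_indic.
  exact: measurable_half_cdf_set.
have Ih (s : R) : \int[unif01 R]_v (\1_(`]-oo, t]%classic) (s * magnitude v)%R)%:E =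
    (half_cdf s t)%:E.
  by rewrite halfE integral_indic ?setIT ?half_cdfK//; exact: measurable_half_cdf_set.
have Zm (s k : R) : (0 <= k)%R -> forall v : R,
  0 <= k%:E * (\1_(`]-oo, t]%classic) (s * magnitude v)%R)%:E.
  by move=> k0 v; rewrite -EFinM lee_fin mulr_ge0.
have Zm' (s k : R) : measurable_fun setT (fun v : R =>
    k%:E * (\1_(`]-oo, t]%classic) (s * magnitude v)%R)%:E).
  by apply: emeasurable_funM; [exact: measurable_cst|exact: mh].
have Zh (s k : R) : (0 <= k)%R ->
    \int[unif01 R]_v (k%:E * (\1_(`]-oo, t]%classic) (s * magnitude v)%R)%:E) =
    k%:E * (half_cdf s t)%:E.
  by move=> k0; rewrite ge0_integralZl ?Ih ?lee_fin.
transitivity (fine (q%:E * (half_cdf 1%R t)%:E + (1 - q)%:E * (half_cdf (- 1)%R t)%:E)).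
  congr fine; rewrite -(Zh 1%R q q0) -(Zh (- 1)%R (1 - q)%R _) ?subr_ge0//.
  rewrite -ge0_integralD//; try exact: Zm'; try by move=> v _; apply: Zm; rewrite ?subr_ge0.
  by apply: eq_integral => v _; rewrite mul1r mulN1r.
by rewrite -!EFinM -EFinD /= /cdf_mean /cdf_tilt; lra.
Qed.

Lemma half_cdf_nondecreasing s : {homo half_cdf s : t t' / (t <= t')%R}.
Proof.
move=> t t' tt'; rewrite -lee_fin !half_cdfK le_measure// ?inE.
- exact: measurable_half_cdf_set.
- exact: measurable_half_cdf_set.
- by move=> v /= /le_trans; apply.
Qed.

Lemma measurable_half_cdf s : measurable_fun setT (half_cdf s).
Proof.
by apply: nondecreasing_measurable => // t t' *; apply: half_cdf_nondecreasing.
Qed.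

Lemma measurable_cdf_mean : measurable_fun setT cdf_mean.
Proof.
by apply: measurable_funM => //; apply: measurable_funD; exact: measurable_half_cdf.
Qed.

Lemma measurable_cdf_tilt : measurable_fun setT cdf_tilt.
Proof.
by apply: measurable_funM => //; apply: measurable_funB; exact: measurable_half_cdf.
Qed.

Hypothesis a0 : (0 < a)%R.

Lemma magnitude_ge v : (a <= magnitude v)%R.
Proof.
have /andP[c0 _] := clip01 v.
by rewrite /magnitude mulrDr mulr1 lerDl mulr_ge0// ltW.
Qed.

Lemma magnitude_gt0 v : (0 < magnitude v)%R.
Proof. exact: lt_le_trans a0 (magnitude_ge v). Qed.

Lemma magnitude_le v : (magnitude v <= 2 * a)%R.
Proof.
have /andP[_ c1] := clip01 v.
rewrite /magnitude mulrDr mulr1 mulr_natl.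
by rewrite mulr2n lerD2l ler_piMr// ltW.
Qed.

Lemma cdf_tilt_le_half t : (`|cdf_tilt t| <= 1 / 2)%R.
Proof.
have /andP[? ?] := half_cdf01 1 t; have /andP[? ?] := half_cdf01 (- 1) t.
by rewrite /cdf_tilt ler_norml; apply/andP; split; lra.
Qed.

(** Magnitudes are at least [a]: at such [t] all the negative mass has been counted and none of the
    positive mass. *)
Lemma cdf_tilt_center t : (- a <= t < a)%R -> (`|cdf_tilt t| = 1 / 2)%R.
Proof.
move=> /andP[t1 t2].
have -> : cdf_tilt t = (- (1 / 2))%R.
  have -> : cdf_tilt t = ((0 - 1) / 2)%R; last by lra.
  congr ((_ - _) / 2)%R; apply: EFin_inj; rewrite half_cdfK.
  - apply: unif01_null; first exact: measurable_half_cdf_set.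
    move=> v _ /=; rewrite mul1r => vt.
    by have := le_lt_trans (le_trans (magnitude_ge v) vt) t2; rewrite ltxx.
  - apply: unif01_full; first exact: measurable_half_cdf_set.
    move=> v _ /=; rewrite mulN1r (le_trans _ t1)// lerN2; exact: magnitude_ge.
by rewrite normrN ger0_norm.
Qed.

Lemma cdf_tilt_far t : (t < - (2 * a))%R \/ (2 * a < t)%R -> cdf_tilt t = 0%R.
Proof.
move=> H; suff E : half_cdf 1 t = half_cdf (- 1) t by rewrite /cdf_tilt E subrr mul0r.
apply: EFin_inj; rewrite !half_cdfK; case: H => H.
- rewrite !unif01_null//; try exact: measurable_half_cdf_set.
  + move=> v v01 /=; rewrite mulN1r => vt.
    by have := magnitude_le v; lra.
  + by move=> v v01 /=; rewrite mul1r => vt; have := magnitude_gt0 v; have := a0; lra.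
- rewrite !unif01_full//; try exact: measurable_half_cdf_set.
  + by move=> v v01 /=; rewrite mulN1r; have := magnitude_gt0 v; have := a0; lra.
  + by move=> v v01 /=; rewrite mul1r; have := magnitude_le v; lra.
Qed.

(** The integrand is at most [1 / 2] and lives on an interval of length [4 a]. *)
Lemma integral_cdf_tilt_le :
  \int[@lebesgueR R]_t `|cdf_tilt t|%:E <= (2 * a)%:E.
Proof.
have mI : measurable (`[(- (2 * a))%R, (2 * a)%R]%classic : set R) by exact: measurable_itv.
apply: (@le_trans _ _ (\int[@lebesgueR R]_t
    ((1 / 2)%:E * (\1_(`[(- (2 * a))%R, (2 * a)%R]%classic) t)%:E))).
  apply: ge0_le_integral => //.
  - by apply/measurable_EFinP; apply: measurableT_comp => //; exact: measurable_cdf_tilt.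
  - by apply: emeasurable_funM => //; apply/measurable_EFinP; exact: measurable_indic.
  - move=> t _; rewrite -EFinM lee_fin indicE.
    case: (boolP (t \in _)) => [_|]; first by rewrite mulr1 cdf_tilt_le_half.
    rewrite notin_setE /= in_itv/= => /negP; rewrite negb_and -!ltNge => /orP H.
    by rewrite cdf_tilt_far ?normr0 ?mulr0//.
rewrite ge0_integralZl//; try by apply/measurable_EFinP; exact: measurable_indic.
rewrite integral_indic// setIT [X in _ * X]lebesgue_measure_itv/= lte_fin.
case: ifP => _; last by rewrite mule0 lee_fin mulr_ge0// ltW.
by rewrite -EFinB -EFinM lee_fin; lra.
Qed.

(** The integrand is [1 / 2] on an interval of length [2 a]. *)
Lemma integral_cdf_tilt_ge :
  a%:E <= \int[@lebesgueR R]_t `|cdf_tilt t|%:E.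
Proof.
have mI : measurable (`[(- a)%R, a[%classic : set R) by exact: measurable_itv.
apply: (@le_trans _ _ (\int[@lebesgueR R]_t ((1 / 2)%:E * (\1_(`[(- a)%R, a[%classic) t)%:E))).
  rewrite ge0_integralZl//; try by apply/measurable_EFinP; exact: measurable_indic.
  rewrite integral_indic// setIT [X in _ * X]lebesgue_measure_itv/= lte_fin.
  by rewrite ifT; [rewrite -EFinB -EFinM lee_fin; lra|have := a0; lra].
apply: ge0_le_integral => //.
- by apply: emeasurable_funM => //; apply/measurable_EFinP; exact: measurable_indic.
- by apply/measurable_EFinP; apply: measurableT_comp => //; exact: measurable_cdf_tilt.
- move=> t _; rewrite -EFinM lee_fin indicE.
  case: (boolP (t \in _)) => [|_]; last by rewrite mulr0.
  by rewrite inE/= in_itv/= => H; rewrite mulr1 cdf_tilt_center.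
Qed.

End response.

(** * The joint law of covariate and response for a given tilt *)

Section tilted_model.
Local Open Scope ereal_scope.
Context (R : realType) (d : nat) (a : R).
Implicit Types (g : {mfun d.-tuple R >-> R}) (x : d.-tuple R).

(** One probability space carries all the models: the covariate and the two uniform variables are
    common, and only the response map depends on the tilt. *)
Definition model_space : Type := (d.-tuple R * (R * R))%type.

HB.instance Definition _ := Measurable.on model_space.

Definition model_prob : probability model_space R := unif_cube R d \x noise R.

Definition covariate (z : model_space) : d.-tuple R := z.1.

Definition plus_prob g x : R := ((1 + g x) / 2)%R.

Definition tilted_response g (z : model_space) : R :=
  response a (plus_prob g z.1) z.2.

Lemma measurable_covariate : measurable_fun setT covariate.
Proof. exact: measurable_fst. Qed.

Lemma measurable_plus_prob g : measurable_fun setT (plus_prob g).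
Proof.
by apply: measurable_funM => //; apply: measurable_funD.
Qed.

Lemma measurable_tilted_response g : measurable_fun setT (tilted_response g).
Proof.
apply: measurable_response_comp; last exact: measurable_snd.
exact: measurableT_comp (measurable_plus_prob g) measurable_fst.
Qed.

HB.instance Definition _ :=
  isMeasurableFun.Build _ _ _ _ covariate measurable_covariate.
HB.instance Definition _ g :=
  isMeasurableFun.Build _ _ _ _ (tilted_response g) (measurable_tilted_response g).

(** This version of the conditional law is explicit at every [x], as its cdf is evaluated
    pointwise. *)
Definition tilted_law g x : {measure set R -> \bar R} :=
  distribution (noise R) (response a (plus_prob g x)).

Let measurable_tilted_law g U : measurable U ->
  measurable_fun [set: d.-tuple R] (tilted_law g ^~ U).
Proof.
move=> mU.
have mA : measurable (tilted_response g @^-1` U).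
  by rewrite -[X in measurable X]setTI; exact: measurable_tilted_response.
have := measurable_fun_xsection (noise R) mA.
congr (measurable_fun _ _); apply/funext => x /=.
by rewrite /xsection/= /tilted_law/= /distribution /pushforward; congr (noise R _);
  apply/seteqP; split => w /=; rewrite ?inE.
Qed.

HB.instance Definition _ g :=
  isKernel.Build _ _ _ _ R (tilted_law g) (@measurable_tilted_law g).

Let tilted_law_setT g x : tilted_law g x setT = 1.
Proof. exact: (probability_setT (distribution (noise R) (response a (plus_prob g x)))). Qed.

HB.instance Definition _ g :=
  Kernel_isProbability.Build _ _ _ _ R (tilted_law g) (tilted_law_setT g).

Definition tilted_kernel g : R.-pker (d.-tuple R) ~> R := tilted_law g.

Definition covariate_rv : {RV model_prob >-> d.-tuple R} := covariate.
Definition response_rv g : {RV model_prob >-> R} := tilted_response g.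

Lemma distribution_covariate A : measurable A ->
  distribution model_prob covariate_rv A = unif_cube R d A.
Proof.
move=> mA; rewrite /distribution /pushforward /=.
have -> : covariate @^-1` A = A `*` setT.
  by apply/seteqP; split => z //= [].
have := product_measure1E (unif_cube R d) (noise R) mA measurableT.
by rewrite [X in _ * X](probability_setT (noise R)) mule1.
Qed.

Lemma tilted_cond_law g : is_conditional_law covariate_rv (response_rv g) (tilted_kernel g).
Proof.
move=> A B mA mB.
rewrite (eq_measure_integral (unif_cube R d)); last first.
  by move=> C mC _; exact: distribution_covariate.
rewrite /joint_law /distribution /pushforward /= /model_prob /=.
rewrite /product_measure1 [RHS]integral_mkcond; apply: eq_integral => x _ /=.
rewrite patchE; case: ifPn => [|xA].
  rewrite inE => xA; transitivity (noise R (response a (plus_prob g x) @^-1` B)) => //.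
  have -> : xsection (pair_fun covariate (tilted_response g) @^-1` (A `*` B)) x =
      response a (plus_prob g x) @^-1` B; last by [].
  apply/seteqP; split => w; rewrite /xsection/= inE/=; first by case.
  by move=> wB; split.
have -> : xsection (pair_fun covariate (tilted_response g) @^-1` (A `*` B)) x = set0.
  apply/seteqP; split => w //=; rewrite /xsection/= inE => -[/= xA' _].
  by move: xA; rewrite notin_setE.
exact: (measure0 (noise R)).
Qed.

Section bounded.
Variable g : {mfun d.-tuple R >-> R}.
Hypothesis g1 : forall x, (`|g x| <= 1)%R.

Lemma plus_prob01 x : (0 <= plus_prob g x <= 1)%R.
Proof.
have := g1 x; rewrite ler_norml => /andP[? ?].
by rewrite /plus_prob; apply/andP; split; lra.
Qed.

Lemma tilted_cdf t x :
  cond_cdf (tilted_kernel g) t x = (cdf_mean a t + g x * cdf_tilt a t)%R.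
Proof.
rewrite /cond_cdf /= response_cdf; last exact: plus_prob01.
by rewrite /plus_prob; congr (_ + _ * _)%R; lra.
Qed.

(** With the sign integrated out its two weights become explicit; atomlessness and the likelihood
    computations start from this form. *)
Lemma ge0_integral_joint_law (f : d.-tuple R * R -> \bar R) :
  measurable_fun setT f -> (forall z, 0 <= f z) ->
  \int[joint_law covariate_rv (response_rv g)]_z f z =
  \int[unif_cube R d]_x \int[unif01 R]_v
    ((plus_prob g x)%:E * f (x, magnitude a v) +
     (1 - plus_prob g x)%:E * f (x, - magnitude a v)%R).
Proof.
move=> mf f0; rewrite ge0_integral_distribution//=.
have mF : measurable_fun setT
    (fun z : d.-tuple R * (R * R) => f (covariate z, tilted_response g z)).
  apply: measurableT_comp mf _.
  exact: (measurable_pair_fun covariate_rv (response_rv g)).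
transitivity (\int[unif_cube R d]_x
    fubini_F (noise R) (fun z => f (covariate z, tilted_response g z)) x).
  apply: (fubini_tonelli1 (m1 := unif_cube R d) (m2 := noise R) _ mF).
  by move=> z; exact: f0.
apply: eq_integral => x _; rewrite /fubini_F /=.
rewrite -(@ge0_integral_response R a _ (fun y => f (x, y)) (plus_prob01 x))//.
exact: measurableT_comp mf (pair1_measurable x).
Qed.

Hypotheses (a0 : (0 < a)%R) (a2 : (2 * a <= 1)%R).

Lemma tilted_atomless y : distribution model_prob (response_rv g) [set y] = 0.
Proof.
have my : measurable [set y] by exact: measurable_set1.
have mh (s : R) : measurable [set v | (s * magnitude a v = y)%R].
  rewrite -[X in measurable X]setTI.
  have mm : measurable_fun setT (fun v => (s * magnitude a v)%R).
    by apply: measurable_funM => //; exact: measurable_magnitude.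
  exact: (mm measurableT _ my).
have null (s : R) : (s == 1)%R || (s == - 1)%R ->
    \int[unif01 R]_v (\1_[set y] (s * magnitude a v)%R)%:E = 0.
  (* As [s * s = 1], [c] is the only possible solution of [s * a * (1 + v) = y] in [[0, 1]], where
     clipping is the identity. *)
  move=> s1; pose c := (s * y / a - 1)%R.
  rewrite (_ : (fun v => _) =
      (fun v => (\1_[set v | (s * magnitude a v = y)%R] v)%:E) :> (R -> \bar R)).
    rewrite integral_indic ?setIT//; apply/eqP; rewrite eq_le measure_ge0 andbT.
    rewrite -(unif01_set1 c) le_unif01// => v v01 /= smv.
    rewrite /c -smv mulrA (_ : s * s = 1)%R ?mul1r.
      by rewrite /magnitude clip_id// mulrC mulKf ?gt_eqF//; lra.
    by case/orP: s1 => /eqP ->; lra.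
  by apply/funext => v; rewrite !indicE.
transitivity (\int[joint_law covariate_rv (response_rv g)]_z (\1_[set y] z.2)%:E).
  rewrite ge0_integral_distribution//=; last first.
    apply/measurable_EFinP; apply: measurableT_comp measurable_snd.
    exact: measurable_indic.
  rewrite /distribution /pushforward -[X in model_prob X]setIT.
  rewrite -(integral_indic model_prob measurableT)//.
rewrite ge0_integral_joint_law//=; last first.
  apply/measurable_EFinP; apply: measurableT_comp measurable_snd.
  exact: measurable_indic.
apply: integral0_eq => x _.
have /andP[q0 q1] := plus_prob01 x.
have mI (s : R) : measurable_fun setT (fun v : R => (\1_[set y] (s * magnitude a v)%R)%:E : \bar R).
  apply/measurable_EFinP.
  apply: (measurableT_comp (f := \1_[set y] : R -> R)); first exact: measurable_indic.
  by apply: measurable_funM => //; exact: measurable_magnitude.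
have Zh (s k : R) : (s == 1)%R || (s == - 1)%R -> (0 <= k)%R ->
    \int[unif01 R]_v (k%:E * (\1_[set y] (s * magnitude a v)%R)%:E) = 0.
  by move=> s1 k0; rewrite ge0_integralZl ?null ?mule0 ?lee_fin.
transitivity (\int[unif01 R]_v ((plus_prob g x)%:E * (\1_[set y] (1 * magnitude a v)%R)%:E +
   (1 - plus_prob g x)%:E * (\1_[set y] (- 1 * magnitude a v)%R)%:E)).
  by apply: eq_integral => v _; rewrite mul1r mulN1r.
rewrite ge0_integralD//.
- by rewrite !Zh ?eqxx ?orbT ?subr_ge0// adde0.
- by move=> v _; rewrite mule_ge0// lee_fin.
- by apply: emeasurable_funM.
- by move=> v _; rewrite mule_ge0// lee_fin subr_ge0.
- by apply: emeasurable_funM.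
Qed.

(** The absolute response does not depend on the sign and is at most [2 * a <= 1], so raising it to
    a power at least 1 does not increase it. *)
Lemma tilted_moment (C delta : R) : (2 * a <= C)%R -> (0 < delta)%R -> forall x,
  \int[tilted_kernel g x]_y (`|y| `^ (2 + delta))%:E <= C%:E.
Proof.
move=> aC delta0 x; rewrite /tilted_kernel /= /tilted_law.
have mp : measurable_fun setT (fun y : R => (`|y| `^ (2 + delta))%:E : \bar R).
  apply/measurable_EFinP.
  have mn : measurable_fun setT (fun y : R => `|y|%R) by exact: normr_measurable.
  exact: (measurableT_comp (@measurable_powR R (2 + delta)%R) mn).
have mmp (s : R) : measurable_fun setT
    (fun v : R => (`|s * magnitude a v| `^ (2 + delta))%:E : \bar R).
  apply: (measurableT_comp mp).
  by apply: measurable_funM => //; exact: measurable_magnitude.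
have p0 (y : R) : 0 <= (`|y| `^ (2 + delta))%:E by rewrite lee_fin powR_ge0.
have -> : \int[distribution (noise R) (response a (plus_prob g x))]_y (`|y| `^ (2 + delta))%:E =
    \int[noise R]_w (`|response a (plus_prob g x) w| `^ (2 + delta))%:E.
  by rewrite ge0_integral_distribution.
rewrite (@ge0_integral_response R a _ _ (plus_prob01 x) mp p0).
under eq_integral => v _.
  rewrite normrN -ge0_muleDl ?lee_fin; last 2 first.
    by have /andP[] := plus_prob01 x.
    by rewrite subr_ge0; have /andP[] := plus_prob01 x.
  rewrite -EFinD (addrC (plus_prob g x)) subrK mul1e.
  over.
apply: (@le_trans _ _ (\int[unif01 R]_v (cst (2 * a)%:E v))); last first.
  by rewrite integral_cst// [X in _ * X](probability_setT (unif01 R)) mule1 lee_fin.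
apply: ge0_le_integral => //.
- by have := mmp 1%R; under eq_fun do rewrite mul1r.
move=> v _; rewrite lee_fin gtr0_norm ?magnitude_gt0//.
have m1 := magnitude_le a0 v.
rewrite (le_trans _ m1)// ge1r_powR//; last by lra.
by rewrite magnitude_gt0// (le_trans m1).
Qed.

End bounded.

End tilted_model.

(** * Membership in the class, likelihood ratios and losses *)

Section tilted_class.
Local Open Scope ereal_scope.
Context (R : realType) (d : nat) (a : R).
Implicit Types (g h : {mfun d.-tuple R >-> R}) (x : d.-tuple R).

Lemma tilted_in_class g (K : R) (ell : nat) (gamma C delta plow pupp : R) :
  (forall x, (`|g x| <= 1)%R) -> (0 < a)%R -> (2 * a <= 1)%R -> (2 * a <= C)%R ->
  (0 < delta)%R -> (plow <= 1)%R -> (1 <= pupp)%R ->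
  smooth_cdf K ell gamma (cond_cdf (tilted_kernel a g)) ->
  in_class K ell gamma C delta plow pupp
    (covariate_rv R d) (response_rv a g) (tilted_kernel a g).
Proof.
move=> g1 a0 a2 aC delta0 pl pu sm; split => //.
- exact: tilted_cond_law.
- rewrite distribution_covariate; first exact: unif_cube_cube.
  exact: (@measurable_cube R d).
- exact: tilted_atomless.
- by move=> x _; exact: tilted_moment.
- exists (\1_(@cube R d) : d.-tuple R -> R); split.
  + by apply: measurable_indic; exact: (@measurable_cube R d).
  + by move=> x.
  + move=> A mA; rewrite distribution_covariate// integral_indic//; last first.
      exact: (@measurable_cube R d).
    by rewrite /unif_cube /mrestr setIC.
  + by move=> x cx; rewrite indicE mem_set//= pl pu.
Qed.

(* The density of the law of the pair for the tilt [g + h] with respect to its law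
   for the tilt [g], when [g] and [h] have disjoint supports. *)
Definition likelihood h (z : d.-tuple R * R) : R :=
  (1 + h z.1 * (if 0 <= z.2 then 1 else - 1))%R.

Lemma measurable_likelihood h : measurable_fun setT (likelihood h).
Proof.
apply: measurable_funD => //; apply: measurable_funM.
  by apply: measurableT_comp => //; exact: measurable_fst.
apply: measurable_fun_ifT => //.
apply: measurable_fun_ler => //; exact: measurable_snd.
Qed.

Lemma likelihood_ge0 h z : (forall x, (`|h x| <= 1)%R) -> (0 <= likelihood h z)%R.
Proof.
move=> /(_ z.1); rewrite ler_norml => /andP[? ?].
by rewrite /likelihood; case: ifP => _; lra.
Qed.

Section density.
Variables (g0 g1 h : {mfun d.-tuple R >-> R}).
Hypothesis a0 : (0 < a)%R.
Hypothesis g01 : forall x, (`|g0 x| <= 1)%R.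
Hypothesis g11 : forall x, (`|g1 x| <= 1)%R.
Hypothesis h1 : forall x, (`|h x| <= 1)%R.
Hypothesis g1E : forall x, g1 x = (g0 x + h x)%R.
Hypothesis g0h : forall x, (g0 x * h x = 0)%R.

Let joint g := joint_law (covariate_rv R d) (response_rv a g).

Lemma likelihood_plus x v : likelihood h (x, magnitude a v) = (1 + h x)%R.
Proof. by rewrite /likelihood /= ltW ?magnitude_gt0// mulr1. Qed.

Lemma likelihood_minus x v : likelihood h (x, - magnitude a v)%R = (1 - h x)%R.
Proof. by rewrite /likelihood /= oppr_ge0 leNgt magnitude_gt0//= mulrN1. Qed.

(** Since [g0 * h = 0], the weight [1 + g1] factors as [(1 + g0) * (1 + h)], and [1 - g1] as
    [(1 - g0) * (1 - h)]. *)
Lemma joint_law_density (f : d.-tuple R * R -> \bar R) :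
  measurable_fun setT f -> (forall z, 0 <= f z) ->
  \int[joint g1]_z f z = \int[joint g0]_z (f z * (likelihood h z)%:E).
Proof.
move=> mf f0.
have mfl : measurable_fun setT (fun z => f z * (likelihood h z)%:E).
  by apply: emeasurable_funM => //; apply/measurable_EFinP; exact: measurable_likelihood.
have fl0 z : 0 <= f z * (likelihood h z)%:E by rewrite mule_ge0// lee_fin likelihood_ge0.
rewrite [LHS](ge0_integral_joint_law a g11 mf f0).
rewrite [RHS](ge0_integral_joint_law a g01 mfl fl0).
apply: eq_integral => x _; apply: eq_integral => v _.
rewrite likelihood_plus likelihood_minus !(muleC (f _)) !muleA -!EFinM.
rewrite /plus_prob g1E; have := g0h x; move: (g0 x) (h x) => p q pq.
congr (_%:E * _ + _%:E * _); first by have := pq; lra.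
by have := pq; lra.
Qed.

(** Averaging [(1 + h) ^ 2] and [(1 - h) ^ 2] with weights [(1 + g0) / 2] and [(1 - g0) / 2] gives
    [1 + h ^ 2 + 2 * g0 * h], whose last term vanishes. *)
Lemma likelihood_second_moment (B : set (d.-tuple R)) (eta p : R) :
  measurable B -> unif_cube R d B = p%:E -> (0 <= eta)%R ->
  (forall x, (`|h x| <= eta * \1_B x)%R) ->
  \int[joint g0]_z (likelihood h z ^+ 2)%:E <= (1 + eta ^+ 2 * p)%:E.
Proof.
move=> mB Bp eta0 hB.
have mB1 : measurable_fun setT (fun x => (\1_B x)%:E : \bar R).
  by apply/measurable_EFinP; exact: measurable_indic.
have ml2 : measurable_fun setT (fun z => (likelihood h z ^+ 2)%:E : \bar R).
  apply/measurable_EFinP; apply: measurable_funX; exact: measurable_likelihood.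
have l20 z : 0 <= (likelihood h z ^+ 2)%:E by rewrite lee_fin sqr_ge0.
rewrite (ge0_integral_joint_law a g01 ml2 l20).
apply: (@le_trans _ _ (\int[unif_cube R d]_x (1 + h x ^+ 2)%:E)).
  rewrite le_eqVlt; apply/orP; left; apply/eqP/eq_integral => x _.
  transitivity (\int[unif01 R]_v (cst (1 + h x ^+ 2)%:E v)); last first.
    by rewrite integral_cst// [X in _ * X](probability_setT (unif01 R)) mule1.
  apply: eq_integral => v _.
  rewrite likelihood_plus likelihood_minus -!EFinM -EFinD /plus_prob /=; congr EFin.
  have := g0h x; move: (g0 x) (h x) => p' q pq.
  rewrite [LHS](_ : _ = 1 + q ^+ 2 + 2 * (p' * q))%R; last by field.
  by rewrite pq mulr0 addr0.
apply: (@le_trans _ _ (\int[unif_cube R d]_x (1 + (eta ^+ 2)%:E * (\1_B x)%:E))).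
  apply: ge0_le_integral => //.
  - by move=> x _; rewrite lee_fin addr_ge0// sqr_ge0.
  - by apply/measurable_EFinP; apply: measurable_funD => //; exact: measurable_funX.
  - by apply: emeasurable_funD => //; apply: emeasurable_funM.
  - move=> x _; rewrite -EFinM -EFinD lee_fin lerD2l -real_normK ?num_real//.
    rewrite (le_trans (lerXn2r 2 _ _ (hB x)))// ?nnegrE ?mulr_ge0//.
    by rewrite exprMn indicE; case: (x \in B); rewrite ?expr1n ?expr0n.
rewrite ge0_integralD//; last 2 first.
- by move=> x _; rewrite mule_ge0// lee_fin ?sqr_ge0.
- by apply: emeasurable_funM.
rewrite ge0_integralZl ?lee_fin ?sqr_ge0// integral_indic// setIT.
rewrite [X in _ * X]Bp -EFinM.
rewrite (_ : (fun _ => _) = cst 1)// integral_cst// mul1e.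
by rewrite [X in X + _](probability_setT (unif_cube R d)).
Qed.

End density.

(** The class and the risk integrate over [measurableTypeR R], the Tonelli arguments over [R]; the
    identity map carries one integral to the other. *)
Lemma lebesgueR_integral (f : R -> \bar R) :
  measurable_fun setT f -> (forall t, 0 <= f t) ->
  \int[@lebesgue_measure R]_t f t = \int[@lebesgueR R]_t f t.
Proof.
move=> mf f0.
pose i : measurableTypeR R -> R := id.
have mi : measurable_fun setT i by move=> _ B mB; rewrite setTI.
rewrite (eq_measure_integral (pushforward lebesgue_measure i)); last first.
  by move=> A _ _; rewrite /pushforward.
by rewrite (ge0_integral_pushforward mi).
Qed.

Section loss.
Variables (n : nat) (Fhat : estimator R d n).

Let sample := (n.-tuple (d.-tuple R * R))%type.

Definition loss g x (S : sample) : \bar R :=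
  \int[@lebesgueR R]_t `|cdf_mean a t + g x * cdf_tilt a t - Fhat (t, x, S)|%:E.

Let integrand g (z : sample * d.-tuple R * R) : \bar R :=
  `|cdf_mean a z.2 + g z.1.2 * cdf_tilt a z.2 - Fhat (z.2, z.1.2, z.1.1)|%:E.

Let measurable_integrand g : measurable_fun setT (integrand g).
Proof.
apply/measurable_EFinP; apply: measurableT_comp => //.
have m2 : measurable_fun setT (fun z : sample * d.-tuple R * R => z.2).
  exact: measurable_snd.
have m12 : measurable_fun setT (fun z : sample * d.-tuple R * R => z.1.2).
  exact: measurableT_comp measurable_snd measurable_fst.
have m11 : measurable_fun setT (fun z : sample * d.-tuple R * R => z.1.1).
  exact: measurableT_comp measurable_fst measurable_fst.
apply: measurable_funB; first apply: measurable_funD.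
- exact: measurableT_comp (measurable_cdf_mean a) m2.
- apply: measurable_funM; last exact: measurableT_comp (measurable_cdf_tilt a) m2.
  by apply: measurableT_comp m12.
- apply: measurableT_comp => //; apply/measurable_fun_pairP; split => //=.
  by apply/measurable_fun_pairP; split.
Qed.

Lemma measurable_loss2 g :
  measurable_fun setT (fun z : sample * d.-tuple R => loss g z.2 z.1).
Proof.
apply: (measurable_fun_fubini_tonelli_F (m2 := @lebesgueR R) _ (measurable_integrand g)).
by move=> z; rewrite lee_fin.
Qed.

Lemma measurable_loss g x : measurable_fun setT (loss g x).
Proof. exact: measurableT_comp (measurable_loss2 g) (pair2_measurable x). Qed.

Lemma loss_ge0 g x S : 0 <= loss g x S.
Proof. by apply: integral_ge0 => t _; rewrite lee_fin. Qed.

Lemma measurable_sample_loss g (nu : probability (d.-tuple R * R)%type R) :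
  measurable_fun setT (fun x => \int[power_measure nu n]_S loss g x S).
Proof.
apply: (measurable_fun_fubini_tonelli_G (m1 := power_measure nu n) _ (measurable_loss2 g)).
by move=> z; exact: loss_ge0.
Qed.

(** Tonelli puts the sample inside, so that two tilts can be tested against each other at each fixed
    [x]. *)
Lemma tilted_risk g : (forall x, (`|g x| <= 1)%R) ->
  risk (covariate_rv R d) (response_rv a g) (tilted_kernel a g) Fhat =
  \int[unif_cube R d]_x
    \int[power_measure (joint_law (covariate_rv R d) (response_rv a g)) n]_S loss g x S.
Proof.
move=> g1; rewrite /risk.
under eq_integral => z _.
  under eq_integral => t _ do rewrite tilted_cdf//.
  rewrite lebesgueR_integral//; last first.
    exact: measurableT_comp (measurable_integrand g) (pair1_measurable z).
  over.
rewrite (fubini_tonelli2 (fun z => loss g z.2 z.1))//=; last 2 first.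
- exact: measurable_loss2.
- by move=> z; exact: loss_ge0.
by apply: eq_measure_integral => A mA _; exact: distribution_covariate.
Qed.

(** The triangle inequality eliminates the estimator; the two cdfs differ by
    [(g1 x - g0 x) * cdf_tilt a t]. *)
Lemma loss_pair g0 g1 x S : (0 < a)%R ->
  (`|g1 x - g0 x| * a)%:E <= loss g0 x S + loss g1 x S.
Proof.
move=> a0.
have m1 g : measurable_fun setT (fun t =>
    `|cdf_mean a t + g x * cdf_tilt a t - Fhat (t, x, S)|%:E).
  exact: measurableT_comp (measurable_integrand g) (pair1_measurable (S, x)).
have m2 : measurable_fun setT (fun t => `|cdf_tilt a t|%:E).
  by apply/measurable_EFinP; apply: measurableT_comp => //; exact: measurable_cdf_tilt.
rewrite /loss -ge0_integralD//.
apply: (@le_trans _ _ (\int[@lebesgueR R]_t (`|g1 x - g0 x|%:E * `|cdf_tilt a t|%:E))).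
  rewrite ge0_integralZl ?lee_fin// EFinM lee_wpmul2l ?lee_fin//.
  exact: integral_cdf_tilt_ge.
apply: ge0_le_integral => //.
- exact: emeasurable_funM.
- exact: emeasurable_funD.
move=> t _; rewrite -EFinM -EFinD lee_fin -normrM.
rewrite [X in (`|X| <= _)%R](_ : _ = (cdf_mean a t + g1 x * cdf_tilt a t - Fhat (t, x, S)) -
  (cdf_mean a t + g0 x * cdf_tilt a t - Fhat (t, x, S)))%R; last by ring.
by rewrite (le_trans (ler_normB _ _))// addrC.
Qed.

Lemma loss_two_points (g0 g1 h : {mfun d.-tuple R >-> R}) (B : set (d.-tuple R))
    (eta p : R) x :
  (0 < a)%R -> (forall y, (`|g0 y| <= 1)%R) -> (forall y, (`|g1 y| <= 1)%R) ->
  (forall y, g1 y = (g0 y + h y)%R) -> (forall y, (g0 y * h y = 0)%R) ->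
  measurable B -> unif_cube R d B = p%:E -> (0 <= eta <= 1)%R ->
  (forall y, (`|h y| <= eta * \1_B y)%R) ->
  ((1 + eta ^+ 2 * p) ^+ n <= 3)%R ->
  (`|h x| * a / 4)%:E <=
    \int[power_measure (joint_law (covariate_rv R d) (response_rv a g0)) n]_S loss g0 x S +
    \int[power_measure (joint_law (covariate_rv R d) (response_rv a g1)) n]_S loss g1 x S.
Proof.
move=> a0 g01 g11 g1E g0h mB Bp /andP[eta0 eta1] hB small.
have h1 y : (`|h y| <= 1)%R.
  rewrite (le_trans (hB y))// indicE; case: (y \in B); rewrite ?mulr1 ?mulr0//.
pose J g : probability _ R := joint_law (covariate_rv R d) (response_rv a g).
apply: (@two_point_lower_bound _ _ R (J g0) (J g1) (likelihood h) (eta ^+ 2 * p)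
  (`|h x| * a) n (loss g0 x) (loss g1 x)).
- exact: measurable_likelihood.
- by move=> z; exact: likelihood_ge0.
- by move=> f mf f0; exact: joint_law_density.
- exact: (likelihood_second_moment a0 g01 g0h mB Bp eta0 hB).
- exact: small.
- exact: measurable_loss.
- by move=> S; exact: loss_ge0.
- exact: measurable_loss.
- by move=> S; exact: loss_ge0.
- by rewrite mulr_ge0// ltW.
- move=> S; apply: le_trans (loss_pair g0 g1 x S a0).
  by rewrite g1E addrAC subrr add0r.
Qed.

End loss.

End tilted_class.

(** * The hypercube of tilts *)

Section bump_bounds.
Context (R : realType) (d ell m : nat).
Hypothesis m0 : (0 < m)%N.
Implicit Types (x : d.-tuple R) (k : cell d m).

Let e0 : 'I_d -> nat := fun=> 0%N.

Lemma bump0_ge0 k x : 0 <= cell_bump ell e0 k x.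
Proof. by apply: prodr_ge0 => i _; exact: profile0_ge0. Qed.

Lemma bump0_le1 k x : cell_bump ell e0 k x <= 1.
Proof.
by apply: prodr_ile1 => i _; rewrite profile0_ge0 profile0_le1.
Qed.

Lemma measurable_bump0 k : measurable_fun setT (cell_bump (R := R) ell e0 k).
Proof.
rewrite /cell_bump; elim: (index_enum _) => [|i s IH].
  by under eq_fun do rewrite big_nil; exact: measurable_cst.
under eq_fun do rewrite big_cons.
apply: measurable_funM => //.
have mv : measurable_fun setT (fun x => m%:R * tnth x i - (k i)%:R).
  apply: measurable_funB => //; apply: measurable_funM => //.
  exact: measurable_tnth.
exact: measurableT_comp (@measurable_profile0 R ell) mv.
Qed.

Definition cell_box k : set (d.-tuple R) :=
  [set x | forall i, (k i)%:R / m%:R <= tnth x i <= ((k i)%:R + 1) / m%:R].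

Let mR : 0 < m%:R :> R. Proof. by rewrite ltr0n. Qed.

Lemma bump0_cell_box k x : cell_bump ell e0 k x <= \1_(cell_box k) x.
Proof.
have [->|nz] := eqVneq (cell_bump ell e0 k x) 0; first by rewrite indicE.
rewrite indicE mem_set ?bump0_le1//= => i.
have /andP[k1 k2] := bump_neq0 (fun=> leq0n ell) nz i.
by rewrite ler_pdivrMr// ler_pdivlMr// mulrC !ltW.
Qed.

Let le_box (l r : 'I_d -> R) (c : R) k : 0 <= c -> (forall i, 0 <= l i) ->
  (forall i, l i + c = r i) -> (forall i, r i <= 1) ->
  unif_cube R d [set x | forall i, l i <= tnth x i <= r i] = (c ^+ d)%:E.
Proof.
move=> c0 l0 lr r1; rewrite unif_cube_box//; last by move=> i; rewrite -lr lerDl.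
congr EFin; under eq_bigr do rewrite -lr addrAC subrr add0r.
by rewrite prodr_const card_ord.
Qed.

Let cell_le1 k i (c : R) : c <= 1 -> ((k i)%:R + c) / m%:R <= 1.
Proof.
move=> c1; rewrite ler_pdivrMr// mul1r (le_trans (_ : _ <= (k i)%:R + 1))//.
  by rewrite lerD2l.
by rewrite natr1 ler_nat.
Qed.

Lemma unif_cell_box k : unif_cube R d (cell_box k) = (m%:R^-1 ^+ d)%:E.
Proof.
apply: le_box => //.
- by move=> i; rewrite mulrDl mul1r.
- by move=> i; exact: cell_le1.
Qed.

Lemma measurable_cell_box k : measurable (cell_box k).
Proof. exact: measurable_box. Qed.

(** The middle half of the cell along each axis: there [v * (1 - v) >= 3 / 16], and its volume is
    [(2 * m) ^ - d]. *)
Let core k : set (d.-tuple R) :=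
  [set x | forall i, ((k i)%:R + 1 / 4) / m%:R <= tnth x i <= ((k i)%:R + 3 / 4) / m%:R].

Let bump_core k x : core k x -> ((3 / 16) ^+ ell.+1) ^+ d <= cell_bump ell e0 k x.
Proof.
move=> kx; rewrite -[X in _ ^+ X]card_ord -prodr_const.
apply: ler_prod => i _; rewrite exprn_ge0//= profile0E.
have := kx i; rewrite ler_pdivrMr// ler_pdivlMr// mulrC => /andP[k1 k2].
have v1 : 1 / 4 <= m%:R * tnth x i - (k i)%:R by lra.
have v2 : m%:R * tnth x i - (k i)%:R <= 3 / 4 by lra.
rewrite clip_id; last by apply/andP; split; lra.
by apply: lerXn2r; rewrite ?nnegrE//; nra.
Qed.

Lemma integral_bump0_ge k :
  ((((3 / 16) ^+ ell.+1 / (2 * m%:R)) ^+ d)%:E <=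
    \int[unif_cube R d]_x (cell_bump ell e0 k x)%:E)%E.
Proof.
have mC : measurable (core k) by exact: measurable_box.
apply: (@le_trans _ _ (\int[unif_cube R d]_x
    ((((3 / 16) ^+ ell.+1) ^+ d)%:E * (\1_(core k) x)%:E))%E).
  rewrite ge0_integralZl_EFin ?exprn_ge0//; last first.
    by apply/measurable_EFinP; exact: measurable_indic.
  rewrite integral_indic// setIT [X in (_ * X)%E](@le_box _ _ (2 * m%:R)^-1)//.
  - by rewrite -EFinM -exprMn.
  - move=> i /=; rewrite invfM; set c := m%:R^-1; lra.
  - by move=> i; apply: cell_le1; lra.
apply: ge0_le_integral => //.
- by apply: emeasurable_funM => //; apply/measurable_EFinP; exact: measurable_indic.
- by apply/measurable_EFinP; exact: measurable_bump0.
move=> x _; rewrite -EFinM lee_fin indicE.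
case: (boolP (x \in _)) => [|_]; last by rewrite mulr0 bump0_ge0.
by rewrite inE mulr1 => /bump_core.
Qed.

End bump_bounds.

Section tilt_family.
Context (R : realType) (d ell m : nat) (A : R).
Hypothesis m0 : (0 < m)%N.
Hypothesis A01 : 0 <= A <= 1.
Implicit Types (x : d.-tuple R) (k : cell d m) (w : cell d m -> bool).

Let e0 : 'I_d -> nat := fun=> 0%N.

Definition tilt w x : R := bump_sum ell 0 (fun k => A * (w k)%:R) e0 x.

Definition single_tilt k x : R := A * cell_bump ell e0 k x.

Lemma measurable_single_tilt k : measurable_fun setT (single_tilt k).
Proof. by apply: measurable_funM => //; exact: measurable_bump0. Qed.

Lemma measurable_tilt w : measurable_fun setT (tilt w).
Proof.
rewrite /tilt /bump_sum; apply: measurable_funD => //.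
elim: (index_enum _) => [|k s IH].
  by under eq_fun do rewrite big_nil; exact: measurable_cst.
under eq_fun do rewrite big_cons.
by apply: measurable_funD => //; apply: measurable_funM => //; exact: measurable_bump0.
Qed.

HB.instance Definition _ k :=
  isMeasurableFun.Build _ _ _ _ (single_tilt k) (measurable_single_tilt k).
HB.instance Definition _ w :=
  isMeasurableFun.Build _ _ _ _ (tilt w) (measurable_tilt w).

(** The cell [k0] is the same for all [w], so at a given [x] a single coordinate of the hypercube
    matters. *)
Lemma exists_single_tilt x : exists k0,
  (forall k, k != k0 -> single_tilt k x = 0) /\
  (forall w, tilt w x = (w k0)%:R * single_tilt k0 x).
Proof.
have [k0 Hk0] := exists_cell ell x m0.
exists k0; split=> [k kk0|w]; first by rewrite /single_tilt Hk0// mulr0.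
rewrite /tilt /bump_sum add0r (bigD1 k0)//= big1 ?addr0.
  by rewrite /single_tilt; ring.
by move=> k kk0; rewrite Hk0// mulr0.
Qed.

Lemma single_tilt_ge0 k x : 0 <= single_tilt k x.
Proof. by case/andP: A01 => ? _; rewrite mulr_ge0// bump0_ge0. Qed.

Lemma single_tilt_le k x : `|single_tilt k x| <= A * \1_(cell_box k) x.
Proof.
rewrite ger0_norm ?single_tilt_ge0//.
by case/andP: A01 => ? _; rewrite ler_wpM2l// bump0_cell_box.
Qed.

Lemma tilt_le1 w x : `|tilt w x| <= 1.
Proof.
have [k0 [_ ->]] := exists_single_tilt x.
have k1 : `|single_tilt k0 x| <= 1.
  case/andP: A01 => ? A1; rewrite normrM ger0_norm// mulr_ile1//.
  by rewrite ger0_norm ?bump0_le1 ?bump0_ge0.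
by rewrite normrM; case: (w k0); rewrite ?normr1 ?mul1r// normr0 mul0r.
Qed.

Definition flip k (w : {ffun cell d m -> bool}) : {ffun cell d m -> bool} :=
  [ffun j => if j == k then ~~ w j else w j].

Lemma flipK k : involutive (flip k).
Proof. by move=> w; apply/ffunP => j; rewrite !ffunE; case: eqP => // _; rewrite negbK. Qed.

Lemma tilt_flip k (w : {ffun cell d m -> bool}) x : ~~ w k ->
  tilt (flip k w) x = tilt w x + single_tilt k x.
Proof.
move=> /negPf wk; rewrite /tilt /bump_sum !add0r (bigD1 k)//= [in RHS](bigD1 k)//=.
rewrite ffunE eqxx wk mulr0 mul0r add0r addrC mulr1; congr (_ + _).
by apply: eq_bigr => j /negPf jk; rewrite ffunE jk.
Qed.

Lemma tiltM_single w k x : ~~ w k -> tilt w x * single_tilt k x = 0.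
Proof.
move=> /negPf wk; have [k0 [H0 ->]] := exists_single_tilt x.
have [<-|kk0] := eqVneq k k0; first by rewrite wk !mul0r.
by rewrite (H0 k)// mulr0.
Qed.

(** There are [m ^ d] cells, each contributing order [A * m ^ - d], so the bound is free of [m]
    apart from [A]. *)
Lemma integral_tilt_ge :
  (((A * (((3 / 16) ^+ ell.+1 / 2) ^+ d)))%:E <=
    \int[unif_cube R d]_x (tilt xpredT x)%:E)%E.
Proof.
case/andP: A01 => A0 _.
have mE k : measurable_fun setT (fun x => (single_tilt k x)%:E).
  by apply/measurable_EFinP; exact: measurable_single_tilt.
have s0 k x : (0 <= (single_tilt k x)%:E)%E by rewrite lee_fin single_tilt_ge0.
have -> : (\int[unif_cube R d]_x (tilt xpredT x)%:E =
    \sum_k \int[unif_cube R d]_x (single_tilt k x)%:E)%E.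
  rewrite -ge0_integral_sum//; apply: eq_integral => x _.
  rewrite sumEFin; congr EFin; rewrite /tilt /bump_sum add0r.
  by apply: eq_bigr => k _; rewrite mulr1.
apply: (@le_trans _ _ (\sum_(k : cell d m)
    (A * ((3 / 16) ^+ ell.+1 / (2 * m%:R)) ^+ d)%:E)%E).
  rewrite sumEFin sumr_const card_ffun !card_ord lee_fin -[_ *+ (m ^ d)]mulr_natl natrX.
  rewrite [leRHS]mulrCA -exprMn [m%:R * _]mulrC -mulrA invfM -mulrA mulVf ?mulr1//.
  by rewrite pnatr_eq0 -lt0n.
apply: lee_sum => k _; under eq_integral do rewrite EFinM.
rewrite ge0_integralZl_EFin//; last 2 first.
- by move=> x _; rewrite lee_fin bump0_ge0.
- by apply/measurable_EFinP; exact: measurable_bump0.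
by rewrite EFinM lee_wpmul2l ?lee_fin//; exact: integral_bump0_ge.
Qed.

Let bump_sumB c (v : cell d m -> R) e x y :
  bump_sum ell c v e x - bump_sum ell c v e y =
  \sum_k v k * (cell_bump ell e k x - cell_bump ell e k y).
Proof.
rewrite /bump_sum opprD addrACA subrr add0r -sumrB.
by apply: eq_bigr => k _; rewrite mulrBr.
Qed.

(** For each [t] the cdf is a bump sum whose weights are proportional to [cdf_tilt a t]. An
    increment of a derivative of order [ell] is thus [D * cdf_tilt a t] with [D] free of [t], and
    the integral over [t] separates. *)
Lemma smooth_tilted w (a K gamma M : R) : 0 < a -> 0 < gamma -> gamma <= 1 ->
  0 <= M ->
  (forall c (v : cell d m -> R) (W : R) (e : 'I_d -> nat) x y,
    (forall i, (e i <= ell)%N) -> (forall k, `|v k| <= W) ->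
    `|bump_sum ell c v e x - bump_sum ell c v e y| <=
      W * M * (m%:R * sup_dist x y) `^ gamma) ->
  2 * a * (m%:R ^+ ell * A * M * m%:R `^ gamma) <= K ->
  smooth_cdf K ell gamma (cond_cdf (tilted_kernel a (tilt w))).
Proof.
move=> a0 g0 g1 M0 holder aK; case/andP: A01 => A0 _.
have FE t x : cond_cdf (tilted_kernel a (tilt w)) t x =
    bump_sum ell (cdf_mean a t) (fun k => cdf_tilt a t * (A * (w k)%:R)) e0 x.
  rewrite tilted_cdf; last exact: tilt_le1.
  rewrite /= /tilt /bump_sum add0r mulr_suml; congr (_ + _).
  by apply: eq_bigr => k _; ring.
have size_word (alpha : multi_index d) : size (mi_word alpha) = mi_size alpha.
  rewrite /mi_word size_flatten /shape -map_comp sumnE big_map big_enum /=.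
  by apply: eq_bigr => i _; rewrite /= size_nseq.
have derivs t alpha (al : (mi_size alpha <= ell)%N) :=
  @pderivs_bump_sum R d ell m _ _ _ (mi_word alpha) m0
    (leq_trans (eq_leq (size_word alpha)) al) (fun x _ => FE t x).
split=> [t alpha al|alpha al x y cx cy]; first by have [] := derivs t alpha al.
pose e i := count_mem i (mi_word alpha).
pose v k := m%:R ^+ ell * (A * (w k)%:R).
pose D := bump_sum ell 0 v e x - bump_sum ell 0 v e y.
have DE t : mi_deriv alpha (cond_cdf (tilted_kernel a (tilt w)) t) x -
    mi_deriv alpha (cond_cdf (tilted_kernel a (tilt w)) t) y = D * cdf_tilt a t.
  have [_ dE] := derivs t alpha (eq_leq al).
  rewrite /mi_deriv (dE x cx) (dE y cy) size_word al.
  rewrite /D !bump_sumB mulr_suml; apply: eq_bigr => k _.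
  by rewrite /v; ring.
under eq_integral => t _ do rewrite DE normrM EFinM.
have mt : measurable_fun setT (fun t => `|cdf_tilt a t|%:E).
  by apply/measurable_EFinP; apply: measurableT_comp => //; exact: measurable_cdf_tilt.
have mDt : measurable_fun setT (fun t => `|D|%:E * `|cdf_tilt a t|%:E)%E.
  by apply: emeasurable_funM.
rewrite (lebesgueR_integral mDt); last by move=> t; rewrite -EFinM lee_fin mulr_ge0.
rewrite ge0_integralZl ?lee_fin//.
apply: (@le_trans _ _ (`|D|%:E * (2 * a)%:E)%E).
  by rewrite lee_wpmul2l ?lee_fin//; exact: integral_cdf_tilt_le.
rewrite -EFinM lee_fin.
have DM : `|D| <= m%:R ^+ ell * A * M * (m%:R * sup_dist x y) `^ gamma.
  apply: holder => [i|k].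
    by rewrite /e (leq_trans (count_size _ _))// size_word al.
  rewrite /v ger0_norm ?mulr_ge0// mulrA ler_piMr ?mulr_ge0//.
  by case: (w k).
rewrite (le_trans (ler_wpM2r _ DM)) ?mulr_ge0 ?(ltW a0)//.
rewrite powRM ?sup_dist_ge0// mulrA mulrC mulrA ler_wpM2r ?powR_ge0//.
Qed.

End tilt_family.

Section averaging.
Context (R : realType) (d ell m n : nat) (a A : R) (Fhat : estimator R d n).
Hypothesis m0 : (0 < m)%N.
Hypothesis A01 : 0 <= A <= 1.
Hypothesis a0 : 0 < a.
Hypothesis small : (1 + A ^+ 2 * m%:R^-1 ^+ d) ^+ n <= 3.
Implicit Types (x : d.-tuple R) (k : cell d m) (w : {ffun cell d m -> bool}).

Let mean_loss w x : \bar R :=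
  (\int[power_measure (joint_law (covariate_rv R d) (response_rv a (tilt ell A w))) n]_S
     loss a Fhat (tilt ell A w) x S)%E.

Let mean_loss_ge0 w x : (0 <= mean_loss w x)%E.
Proof. by apply: integral_ge0 => S _; exact: loss_ge0. Qed.

Let measurable_mean_loss w : measurable_fun setT (mean_loss w).
Proof. exact: measurable_sample_loss. Qed.

(** The claim is symmetric in [w] and its flip, so one may start from the vertex without bump [k]
    and test it against the one where the bump is added. *)
Lemma mean_loss_flip w k x :
  ((single_tilt ell A k x * a / 4)%:E <= mean_loss w x + mean_loss (flip k w) x)%E.
Proof.
wlog wk : w / ~~ w k.
  move=> H; have [wk|/H//] := boolP (w k).
  have := H (flip k w); rewrite flipK addeC; apply.
  by rewrite ffunE eqxx wk.
rewrite -[single_tilt _ _ _ _]ger0_norm ?single_tilt_ge0//.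
apply: (@loss_two_points R d a n Fhat _ _ (single_tilt ell A k) (cell_box k) A
  (m%:R^-1 ^+ d)) => //.
- by move=> y; exact: tilt_le1.
- by move=> y; exact: tilt_le1.
- by move=> y; exact: tilt_flip.
- by move=> y; exact: tiltM_single.
- exact: measurable_cell_box.
- exact: unif_cell_box.
- by move=> y; exact: single_tilt_le.
Qed.

(** Pairing each vertex with its flip at the cell of [x] counts every mean loss twice, which turns
    the factor [1 / 4] into [1 / 8]. *)
Lemma sum_mean_loss x :
  ((#|{ffun cell d m -> bool}|%:R * (a / 8) * @tilt R d ell m A xpredT x)%:E <=
   \sum_w mean_loss w x)%E.
Proof.
have [k [_ ->]] := exists_single_tilt ell A m0 x; rewrite mul1r.
set N := #|_|; set S := (\sum_w _)%E; set r := _ * _.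
have : ((r + r)%:E <= S + S)%E.
  have -> : (S + S = \sum_w (mean_loss w x + mean_loss (flip k w) x))%E.
    rewrite big_split; congr (_ + _)%E.
    exact: (reindex_inj (inv_inj (flipK k))).
  have -> : (r + r)%:E = (\sum_(w : {ffun cell d m -> bool})
      (single_tilt ell A k x * a / 4)%:E)%E.
    rewrite sumEFin sumr_const -/N -[_ *+ N]mulr_natl /r; congr EFin.
    by field.
  by apply: lee_sum => w _; exact: mean_loss_flip.
(* Halving without dividing in the extended reals: [S < r] would give [S + S < r + r]. *)
by rewrite EFinD leNgt; apply: contraNle => Sr; rewrite lteD.
Qed.

(** A common bound on the risks bounds their average over the vertices, which [sum_mean_loss]
    controls after integration over [x]. *)
Lemma le_sup_risk (s : \bar R) :
  (forall w, (risk (covariate_rv R d) (response_rv a (tilt ell A w))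
    (tilted_kernel a (tilt ell A w)) Fhat <= s)%E) ->
  ((a / 8 * (A * ((3 / 16) ^+ ell.+1 / 2) ^+ d))%:E <= s)%E.
Proof.
move=> risk_s; set r := a / 8 * _.
pose N := #|{ffun cell d m -> bool}|.
have N0 : 0 < N%:R :> R by rewrite ltr0n; apply/card_gt0P; exists [ffun=> true].
have : ((N%:R * r)%:E <= \sum_(w : {ffun cell d m -> bool}) s)%E.
  apply: (@le_trans _ _ (\sum_w \int[unif_cube R d]_x mean_loss w x)%E); last first.
    apply: lee_sum => w _; apply: le_trans (risk_s w).
    by rewrite tilted_risk// => x; exact: tilt_le1.
  rewrite -ge0_integral_sum//.
  apply: (@le_trans _ _ (\int[unif_cube R d]_x
      ((N%:R * (a / 8))%:E * (@tilt R d ell m A xpredT x)%:E))%E).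
    rewrite ge0_integralZl_EFin//; last 3 first.
    - move=> x _; rewrite lee_fin; have [k [_ ->]] := exists_single_tilt ell A m0 x.
      by rewrite mul1r single_tilt_ge0.
    - by apply/measurable_EFinP; exact: measurable_tilt.
    - by rewrite mulr_ge0 ?ler0n ?divr_ge0 ?(ltW a0).
    rewrite /r mulrA EFinM lee_wpmul2l ?lee_fin ?mulr_ge0 ?divr_ge0 ?(ltW a0)//.
    exact: integral_tilt_ge.
  apply: ge0_le_integral => //.
  - move=> x _; have [k [_ ->]] := exists_single_tilt ell A m0 x.
    by rewrite mul1r -EFinM lee_fin mulr_ge0 ?single_tilt_ge0// mulr_ge0 ?divr_ge0 ?(ltW a0).
  - apply: emeasurable_funM => //; apply/measurable_EFinP; exact: measurable_tilt.
  - exact: emeasurable_sum.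
  - by move=> x _; rewrite -EFinM; exact: sum_mean_loss.
have : (0 <= s)%E.
  apply: le_trans (risk_s [ffun=> true]); apply: integral_ge0 => z _.
  by apply: integral_ge0 => t _; rewrite lee_fin.
case: s risk_s => [v||] // _ _; last by rewrite leey.
by rewrite sumEFin sumr_const !lee_fin => Nr; rewrite -(ler_pM2l N0) [leRHS]mulr_natl.
Qed.

End averaging.

(** * Choice of the grid size and conclusion *)

Lemma expr_1D_le3 (R : realType) (x : R) n : 0 <= x -> n%:R * x <= 1 / 2 ->
  (1 + x) ^+ n <= 3.
Proof.
move=> x0 nx.
(* At [k = n] the second factor is at least [1 / 2], so the power is at most 2. *)
have H k : k%:R * x <= 1 -> (1 + x) ^+ k * (1 - k%:R * x) <= 1.
  elim: k => [|k IH]; first by rewrite expr0 mul0r subr0 mul1r.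
  rewrite -natr1 => kx.
  have kx1 : k%:R * x <= 1 by nra.
  apply: le_trans (IH kx1); rewrite exprSr -mulrA ler_wpM2l ?exprn_ge0 ?addr_ge0//.
  have k0 : 0 <= k%:R * x by rewrite mulr_ge0.
  by nra.
have n1 : n%:R * x <= 1 by lra.
have := H n n1; have : 0 <= (1 + x) ^+ n by rewrite exprn_ge0 ?addr_ge0.
by nra.
Qed.

(* [m] is of order [n ^ (1 / (2 * beta + d))], the grid size at which flipping a
   bump is no longer detectable from the sample. *)
Lemma exists_grid_size (R : realType) (n d : nat) (beta : R) :
  (1 <= n)%N -> 0 < beta -> exists m : nat,
  [/\ (0 < m)%N,
      n%:R * ((m%:R `^ (- beta)) ^+ 2 * m%:R^-1 ^+ d) <= 1 &
      2 `^ (- beta) * n%:R `^ (- (beta / (2 * beta + d%:R))) <= m%:R `^ (- beta) :> R].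
Proof.
move=> n1 b0; pose D := 2 * beta + d%:R.
have D0 : 0 < D by rewrite ltr_wpDr// mulr_gt0.
pose r := n%:R `^ (D^-1) : R.
have nR : 1 <= n%:R :> R by rewrite ler1n.
have r1 : 1 <= r.
  by rewrite -(powRr0 (n%:R : R)) /r ler_powR// invr_ge0 ltW.
have r0 : 0 <= r by rewrite (le_trans ler01).
have /andP[tr rt] := truncn_itv r0.
(* Since [1 <= r], this gives [r <= m <= 2 * r]: the lower bound yields the testing condition, the
   upper one the rate, with the loss [2 ^ - beta]. *)
exists (Num.truncn r).+1; set m := (Num.truncn r).+1.
have m0 : 0 < m%:R :> R by rewrite ltr0n.
have rm : r <= m%:R by rewrite ltW.
have m2r : m%:R <= 2 * r by rewrite /m -natr1; lra.
have rnn : r \is Num.nneg by rewrite nnegrE.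
have mnn : (m%:R : R) \is Num.nneg by rewrite nnegrE ltW.
split => //.
- have nm : n%:R <= m%:R `^ D :> R.
    have -> : n%:R = r `^ D by rewrite /r -powRrM mulVf ?lt0r_neq0// powRr1.
    exact: (ge0_ler_powR (ltW D0) rnn mnn rm).
  rewrite powRN !exprVn -invfM ler_pdivrMr ?mul1r//; last first.
    by rewrite mulr_gt0// exprn_gt0// powR_gt0.
  rewrite (le_trans nm)// /D mulr_natl mulr2n !powRD ?(gt_eqF m0) ?implybT//.
  by rewrite powR_mulrn ?expr2// ltW.
- rewrite !powRN -invfM lef_pV2 ?posrE ?mulr_gt0 ?powR_gt0//; last by rewrite (lt_le_trans ltr01).
  have -> : n%:R `^ (beta / D) = r `^ beta by rewrite mulrC powRrM.
  rewrite -powRM//; apply: ge0_ler_powR; rewrite ?nnegrE ?(ltW b0) ?(ltW m0)//.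
  exact: mulr_ge0.
Qed.

Theorem mainTheorem2 (R : realType) (d : nat) (K C delta plow pupp : R)
    (ell : nat) (gamma beta : R) :
  (1 <= d)%N -> 0 < K -> 0 < C -> 0 < delta ->
  0 < plow -> plow <= pupp -> plow <= 1 -> 1 <= pupp ->
  0 < gamma -> gamma <= 1 -> beta = ell%:R + gamma ->
  exists c : R, 0 < c /\
    forall n : nat, (1 <= n)%N ->
      ((c * n%:R `^ (- (beta / (2 * beta + d%:R))))%:E <=
        minimax_risk d K ell gamma C delta plow pupp n)%E.
Proof.
move=> _ K0 C0 delta0 _ _ pl pu gamma0 gamma1 betaE.
have beta0 : 0 < beta by rewrite betaE ltr_wpDl.
have [M M0 holder] := bump_sum_holder R d ell.
(* The two bounds on [a] are those asked by the moment condition. *)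
pose a := Num.min (1 / 2) (C / 2).
have a0 : 0 < a by rewrite lt_min !divr_gt0.
have a1 : 2 * a <= 1.
  have : a <= 1 / 2 by rewrite ge_min lexx.
  lra.
have aC : 2 * a <= C.
  have : a <= C / 2 by rewrite ge_min lexx orbT.
  lra.
(* The first bound makes [A0 ^ 2] at most [1 / 2], as the testing condition asks; the second
   enforces the smoothness constant [K]. *)
pose A0 := Num.min (1 / 2) (K / (2 * a * M)).
have A00 : 0 < A0 by rewrite lt_min !divr_gt0// !mulr_gt0.
have A02 : A0 <= 1 / 2 by rewrite ge_min lexx.
have A0K : 2 * a * M * A0 <= K.
  by rewrite mulrC -ler_pdivlMr ?mulr_gt0// ge_min lexx orbT.
pose b := ((3 / 16) ^+ ell.+1 / 2) ^+ d : R.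
have b0 : 0 < b by rewrite exprn_gt0// divr_gt0// exprn_gt0.
exists (a / 8 * (A0 * 2 `^ (- beta) * b)); split.
  by rewrite !mulr_gt0// ?invr_gt0// powR_gt0.
move=> n n1; apply: le_ereal_inf_tmp => _ [Fhat _ <-].
have [m [m0 nm mn]] := @exists_grid_size R n d beta n1 beta0.
have mR : 1 <= m%:R :> R by rewrite ler1n.
have mR0 : 0 < m%:R :> R by rewrite ltr0n.
pose mb := m%:R `^ (- beta) : R.
have mb0 : 0 < mb by rewrite powR_gt0.
have mb1 : mb <= 1.
  by rewrite -(powRr0 (m%:R : R)) /mb ler_powR// oppr_le0 ltW.
pose A := A0 * mb.
have A01 : 0 <= A <= 1.
  by rewrite /A mulr_ge0 ?mulr_ile1 ?(ltW A00) ?(ltW mb0)//; lra.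
have small : (1 + A ^+ 2 * m%:R^-1 ^+ d) ^+ n <= 3.
  apply: expr_1D_le3; first by rewrite mulr_ge0 ?sqr_ge0// exprn_ge0// invr_ge0.
  rewrite /A exprMn -mulrA mulrCA.
  apply: (le_trans (ler_piMr _ nm)); first exact: sqr_ge0.
  by rewrite expr2; nra.
apply: (@le_trans _ _ (a / 8 * (A * b))%:E).
  rewrite lee_fin -[leLHS]mulrA ler_wpM2l ?divr_ge0 ?(ltW a0)//.
  rewrite [leLHS]mulrAC ler_wpM2r ?(ltW b0)// /A -[leLHS]mulrA.
  by rewrite ler_wpM2l ?(ltW A00).
apply: (@le_sup_risk R d ell m n a A Fhat m0 A01 a0 small) => w.
apply: ereal_sup_ubound.
exists _, (model_space R d), (model_prob R d), (covariate_rv R d),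
  (response_rv a (tilt ell A w)), (tilted_kernel a (tilt ell A w)).
split => //; apply: tilted_in_class => //; first by move=> x; exact: tilt_le1.
apply: (@smooth_tilted R d ell m A m0 A01 _ _ _ _ M) => //; first exact: ltW.
  by move=> c v W e x y el vW; exact: holder.
(* The powers of [m] cancel because [beta = ell + gamma]: this is why the bumps have height of order
   [m ^ - beta]. *)
have -> : m%:R ^+ ell * A * M * m%:R `^ gamma = M * A0.
  have E : m%:R ^+ ell * m%:R `^ gamma * mb = 1.
    rewrite -powR_mulrn ?(ltW mR0)// -powRD ?(gt_eqF mR0) ?implybT//.
    by rewrite -betaE -powRD ?(gt_eqF mR0) ?implybT// subrr powRr0.
  transitivity (M * A0 * (m%:R ^+ ell * m%:R `^ gamma * mb)); last by rewrite E mulr1.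
  by rewrite /A; ring.
by rewrite mulrA.
Qed.
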